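(* Let $n\ge 2$ and, for $i=1,\dots,n$, let $L_i$ be a closed embedded oriented minimal submanifold of positive dimension $k_i$ in the unit sphere $\mathbb S^{N_i}\subset\mathbb R^{N_i+1}$. Let $L_1\dot\times\cdots\dot\times L_n$ be their minimal product. Then the cone $C(L_1\dot\times\cdots\dot\times L_n)\subset \mathbb R^{N_1+1}\oplus\cdots\oplus\mathbb R^{N_n+1}$ supports no globally defined smooth calibration; that is, there is no smooth calibration form $\phi$ of degree $k_1+\cdots+k_n+1$ defined on the whole Euclidean space $\mathbb R^{N_1+1}\oplus\cdots\oplus\mathbb R^{N_n+1}$ which calibrates $C(L_1\dot\times\cdots\dot\times L_n)$.
   Context: Closed submanifold means compact without boundary; minimal means vanishing mean curvature in the sphere. Minimal product: with $k_i=\dim L_i>0$, $k=k_1+\cdots+k_n$ and $\lambda_i=\sqrt{k_i/k}$, set $L_1\dot\times\cdots\dot\times L_n=\{(\lambda_1x_1,\dots,\lambda_nx_n): x_i\in L_i\}\subset\mathbb S^{N_1+\cdots+N_n+n-1}$, with the product orientation. It is a $k$-dimensional minimal submanifold of that sphere. Cone: $C(L)=\{tx: x\in L,\ t\in[0,\infty)\}$, which for $L$ oriented is oriented by the radial direction followed by the orientation of $L$ (the choice of sign convention is immaterial), and is regarded as a current of locally finite mass. Calibration: on a Riemannian manifold $(X,g)$, the comass of an $m$-form $\phi$ at $x$ is $\|\phi\|_{x,g}^*=\max\{\phi_x(e_1\wedge\cdots\wedge e_m): e_1\wedge\cdots\wedge e_m \text{ a unit simple } m\text{-vector at } x\}$.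 A smooth $m$-form $\phi$ on $X$ is a calibration if $d\phi=0$ and $\sup_X\|\phi\|_g^*=1$. Here $X$ is the entire Euclidean space with its flat metric (''globally defined''). An $m$-current $T=\overrightarrow T\cdot\|T\|$ of locally finite mass is calibrated by $\phi$ (equivalently, $T$ supports $\phi$) if $\phi_x(\overrightarrow T_x)=1$ for $\|T\|$-almost every $x$. For the cone over an oriented submanifold this says that $\phi$ equals $1$ on the oriented unit tangent $m$-vectors at almost every point of the cone. *)

(* Defs.v *)
From HB Require Import structures.
From mathcomp Require Import all_boot all_order all_algebra.
From mathcomp Require Import all_classical all_reals all_analysis.
Set Implicit Arguments.
Unset Strict Implicit.
Unset Printing Implicit Defensive.
Import Order.TTheory GRing.Theory Num.Theory.
Import numFieldNormedType.Exports.
Local Open Scope classical_set_scope.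
Local Open Scope ring_scope.

(* Vectors of Euclidean space are row vectors.  The library norm on 'rV[R]_d is
   the sup norm: it gives the right topology, but all metric notions below go
   through [dot]. *)
Definition dot (R : realType) (d : nat) (u v : 'rV[R]_d) : R :=
  (u *m v^T) 0 0.

Definition unit_sphere (R : realType) (d : nat) : set 'rV[R]_d :=
  [set x | dot x x = 1].

(* Meaningful for open U. *)
Fixpoint Ck_on (R : realType) (V W : normedModType R) (U : set V)
    (n : nat) (f : V -> W) : Prop :=
  if n is n'.+1 then
    (forall x, U x -> differentiable f x) /\
    (forall v, Ck_on U n' (fun x => 'D_v f x))
  else forall x, U x -> {for x, continuous f}.

Definition smooth_on (R : realType) (V W : normedModType R) (U : set V)
    (f : V -> W) : Prop := forall n, Ck_on U n f.

(* Embedded k-dimensional smooth submanifolds of R^d, through slice charts. *)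
Definition embedded_submanifold (R : realType) (d k : nat)
    (M : set 'rV[R]_d) : Prop :=
  (k <= d)%N /\
  forall p, M p ->
    exists (U V : set 'rV[R]_d) (f g : 'rV[R]_d -> 'rV[R]_d),
      [/\ open U /\ open V, U p,
          smooth_on U f /\ smooth_on V g,
          (forall x, U x -> V (f x) /\ g (f x) = x) /\
          (forall y, V y -> U (g y) /\ f (g y) = y) &
          forall x, U x -> (M x <-> forall j : 'I_d, (k <= j)%N -> f x 0 j = 0)].

Definition tangent (R : realType) (d : nat) (M : set 'rV[R]_d)
    (p v : 'rV[R]_d) : Prop :=
  exists (e : R) (c : R -> 'rV[R]_d),
    [/\ 0 < e, smooth_on [set t : R | `|t| < e] c,
        (forall t, `|t| < e -> M (c t)), c 0 = p & 'D_1 c 0 = v].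

(* A set with, at each point, its set of positively oriented tangent k-frames;
   the vectors of a frame are the rows of a k x d matrix. *)
Record oriented_set (R : realType) (d k : nat) := OrientedSet {
  carrier : set 'rV[R]_d ;
  pos_frame : 'rV[R]_d -> set 'M[R]_(k, d) }.

(* [pos_frame] picks one of the two orientation classes of bases of each
   tangent space, and admits local continuous sections. *)
Definition is_orientation (R : realType) (d k : nat)
    (L : oriented_set R d k) : Prop :=
  [/\ forall p B, carrier L p -> pos_frame L p B ->
        row_free B /\ (forall i, tangent (carrier L) p (row i B)),
      forall p B (A : 'M[R]_k), carrier L p -> pos_frame L p B ->
        (pos_frame L p (A *m B) <-> 0 < \det A) &
      forall p, carrier L p ->
        exists (U : set 'rV[R]_d) (F : 'rV[R]_d -> 'M[R]_(k, d)),
          [/\ open U, U p, {within carrier L `&` U, continuous F} &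
              forall q, carrier L q -> U q -> pos_frame L q (F q)]].

(* Closed: compact without boundary.  The empty set is excluded. *)
Definition closed_oriented_submanifold (R : realType) (d k : nat)
    (L : oriented_set R d k) : Prop :=
  [/\ carrier L !=set0, compact (carrier L),
      embedded_submanifold k (carrier L) & is_orientation L].

(* h = II_p(u, v) for the submanifold M of the unit sphere.  Y extends v to a
   local vector field tangent to M; the Levi-Civita derivative of the sphere is
   D_u Y - <D_u Y, p> p, and h is its component orthogonal to T_p M. *)
Definition second_fundamental_form (R : realType) (d : nat)
    (M : set 'rV[R]_d) (p u v h : 'rV[R]_d) : Prop :=
  exists (U : set 'rV[R]_d) (Y : 'rV[R]_d -> 'rV[R]_d),
    [/\ open U /\ U p, smooth_on U Y,
        (forall q, U q -> M q -> tangent M q (Y q)) /\ Y p = v,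
        tangent M p ('D_u Y p - dot ('D_u Y p) p *: p - h) &
        forall z, tangent M p z -> dot h z = 0].

(* Trace of the second fundamental form (not divided by k). *)
Definition mean_curvature_vector (R : realType) (d k : nat)
    (M : set 'rV[R]_d) (p H : 'rV[R]_d) : Prop :=
  exists (B : 'M[R]_(k, d)) (h : 'I_k -> 'rV[R]_d),
    [/\ B *m B^T = 1%:M, forall i, tangent M p (row i B),
        forall i, second_fundamental_form M p (row i B) (row i B) (h i) &
        H = \sum_i h i].

Definition minimal_in_sphere (R : realType) (d k : nat)
    (M : set 'rV[R]_d) : Prop :=
  M `<=` @unit_sphere R d /\
  forall p, M p -> mean_curvature_vector k M p 0.

(* The direct sum of the R^(d i) is 'rV_(\sum_i d i), with vectors
   \mxrow_i x i; this is the rectangular analogue of \mxdiag. *)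
Definition block_diag (R : realType) (n : nat) (k d : 'I_n -> nat)
    (B : forall i, 'M[R]_(k i, d i)) : 'M[R]_(\sum_i k i, \sum_i d i) :=
  \mxblock_(i < n, j < n) (if i == j then conform_mx 0 (B i) else 0).

Definition minimal_weight (R : realType) (n : nat) (k : 'I_n -> nat)
    (i : 'I_n) : R :=
  Num.sqrt ((k i)%:R / (\sum_j k j)%N%:R).

Definition product_point (R : realType) (n : nat) (k d : 'I_n -> nat)
    (x : forall i, 'rV[R]_(d i)) : 'rV[R]_(\sum_i d i) :=
  \mxrow_(i < n) (minimal_weight R k i *: x i).

Definition minimal_product (R : realType) (n : nat) (k d : 'I_n -> nat)
    (L : forall i, oriented_set R (d i) (k i)) :
    oriented_set R (\sum_i d i) (\sum_i k i) :=
  OrientedSet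
    [set y | exists x : forall i, 'rV[R]_(d i),
       (forall i, carrier (L i) (x i)) /\ y = product_point k x]
    (fun y => [set F | exists (x : forall i, 'rV[R]_(d i))
                              (B : forall i, 'M[R]_(k i, d i)) A,
       [/\ forall i, carrier (L i) (x i), y = product_point k x,
           forall i, pos_frame (L i) (x i) (B i), 0 < \det A &
           F = A *m block_diag B]]).

(* Radial direction first; no frame at the apex. *)
Definition cone (R : realType) (d k : nat) (L : oriented_set R d k) :
    oriented_set R d (1 + k) :=
  OrientedSet
    [set y | exists x t, [/\ carrier L x, 0 <= t & y = t *: x]]
    (fun y => [set F | exists x t (B : 'M[R]_(k, d)) A,
       [/\ carrier L x, 0 < t /\ y = t *: x, pos_frame L x B, 0 < \det A &
           F = A *m col_mx x B]]).

(* |e_1 /\ ... /\ e_m| = 1, for e_1, ..., e_m the rows of E: the squared norm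
   of a simple m-vector is its Gram determinant. *)
Definition unit_simple (R : realType) (d m : nat) (E : 'M[R]_(m, d)) : Prop :=
  \det (E *m E^T) = 1.

(* A differential m-form on R^d: phi x E is phi_x(e_1, ..., e_m), for
   e_1, ..., e_m the rows of E. *)
Definition dform (R : realType) (d m : nat) := 'rV[R]_d -> 'M[R]_(m, d) -> R.

Definition multilinear_alternating (R : realType) (d m : nat)
    (w : 'M[R]_(m, d) -> R) : Prop :=
  (forall (A B C : 'M[R]_(m, d)) i0 b c,
     row i0 A = b *: row i0 B + c *: row i0 C ->
     row' i0 B = row' i0 A -> row' i0 C = row' i0 A ->
     w A = b * w B + c * w C) /\
  (forall (A : 'M[R]_(m, d)) i1 i2, i1 != i2 -> row i1 A = row i2 A -> w A = 0).

Definition smooth_form (R : realType) (d m : nat) (phi : dform R d m) : Prop :=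
  (forall x, multilinear_alternating (phi x)) /\
  (forall E, smooth_on setT (phi ^~ E : 'rV[R]_d -> R)).

Definition ext_derivative (R : realType) (d m : nat) (phi : dform R d m) :
    dform R d m.+1 :=
  fun x E => \sum_(i < m.+1)
    (-1) ^+ i * 'D_(row i E) (fun y => phi y (row' i E)) x.

Definition comass (R : realType) (d m : nat) (w : 'M[R]_(m, d) -> R) : \bar R :=
  ereal_sup [set (w E)%:E | E in @unit_simple R d m].

Definition calibration (R : realType) (d m : nat) (phi : dform R d m) : Prop :=
  [/\ smooth_form phi,
      forall x E, ext_derivative phi x E = 0 &
      ereal_sup [set comass (phi x) | x in setT] = 1%E].

(* 0 is added so that the empty set has diameter 0 rather than -oo. *)
Definition diameter (R : realType) (d : nat) (A : set 'rV[R]_d) : \bar R :=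
  ereal_sup (0%E |` [set (Num.sqrt (dot (xy.1 - xy.2) (xy.1 - xy.2)))%:E
                    | xy in A `*` A]).

(* Hausdorff (outer) measure for m > 0, without the normalising constant, which
   does not affect null sets. *)
Definition hausdorff_delta (R : realType) (d m : nat) (delta : R)
    (A : set 'rV[R]_d) : \bar R :=
  ereal_inf [set (\sum_(i <oo) diameter (U i) ^+ m)%E
            | U in [set U : nat -> set 'rV[R]_d |
                A `<=` \bigcup_i U i /\
                forall i, (diameter (U i) <= delta%:E)%E]].

Definition hausdorff (R : realType) (d m : nat) (A : set 'rV[R]_d) : \bar R :=
  ereal_sup [set hausdorff_delta m delta A | delta in [set r : R | 0 < r]].

(* The current carried by C has mass measure H^m restricted to C. *)
Definition calibrates (R : realType) (d m : nat) (phi : dform R d m)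
    (C : oriented_set R d m) : Prop :=
  hausdorff m [set x | carrier C x /\
    ~ (forall E, pos_frame C x E -> unit_simple E -> phi x E = 1)] = 0%E.

(* Main.v *)
Require Import Defs.
From mathcomp Require Import all_boot all_order all_algebra.
From mathcomp Require Import all_classical all_reals all_analysis.
From mathcomp Require Import ring lra.
Set Implicit Arguments.
Unset Strict Implicit.
Unset Printing Implicit Defensive.
Import Order.TTheory GRing.Theory Num.Theory.
Import numFieldNormedType.Exports.
Local Open Scope classical_set_scope.
Local Open Scope ring_scope.
Local Notation dfwith := eqtype.dfwith.

(** Suppose that a smooth calibration [phi] calibrates the cone.  The tangent
    planes of a cone are constant along its rays, so letting the base point tend
    to the apex shows that the form with constant coefficients [w = phi 0] takes
    the volume as its value, up to sign, on every tangent frame of the cone,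
    while [w ^ 2] is bounded by the squared volume on all frames
    ([calibrated_frame], [calibration_le_volume]).  The calibration condition is
    only given almost everywhere for the Hausdorff measure.  It holds on a dense
    subset of the cone because each piece of the cone has positive measure: it
    is the image of a cube under a parametrisation whose inverse is Lipschitz
    ([cone_param_expanding]), and a cover of a cube by sets of small diameter
    satisfies a volume inequality, proved by counting the points of a fine grid
    ([cube_cover], [hausdorff_expanding]).

    No constant form behaves like this ([no_constant_calibration]).  Single out
    one factor [L_i] and write the unit direction of the cone as [l e + x'],
    where [e] is the position [q] in [L_i], placed in its block, [l] is the
    weight of this factor, and [x'] collects the other factors; [x'] is not zero
    since there are at least two factors.  The vector [y = (1 - l^2) e - l x'] is
    normal to the cone, so by the first cousin principle ([first_cousin]) the
    form [w] vanishes whenever [y] replaces one vector of a tangent frame.  Now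
    freeze the points and frames of the other factors, and let [om] be the form
    of degree [k_i] obtained from [w] by inserting [x'] and these frames.  As
    [x'] and [l e + x'] span the same plane as [l e + x'] and [y], the form [om]
    does not vanish on the tangent spaces of [L_i], but its contraction with the
    position vector [q] does vanish along [L_i].  This is impossible
    ([no_radially_null_form]), because the exterior derivative of the
    contraction of [om] with the position vector is [k_i om]. *)

(** * Alternating forms and volume *)

Definition set_row (T : Type) (m d : nat) (i : 'I_m) (v : 'rV[T]_d)
    (A : 'M[T]_(m, d)) : 'M[T]_(m, d) :=
  \matrix_(a, b) if a == i then v 0 b else A a b.

Section SetRow.
Variables (T : Type) (m d : nat).
Implicit Types (A : 'M[T]_(m, d)) (u v : 'rV[T]_d) (i j : 'I_m).

Lemma row_set_row i v A : row i (set_row i v A) = v.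
Proof. by apply/rowP => b; rewrite !mxE eqxx. Qed.

Lemma row_set_row_neq i j v A : j != i -> row j (set_row i v A) = row j A.
Proof. by move=> ji; apply/rowP => b; rewrite !mxE (negbTE ji). Qed.

Lemma row'_set_row i v A : row' i (set_row i v A) = row' i A.
Proof. by apply/matrixP => a b; rewrite !mxE eq_sym (negbTE (neq_lift _ _)). Qed.

Lemma set_row_set_row i u v A : set_row i u (set_row i v A) = set_row i u A.
Proof. by apply/matrixP => a b; rewrite !mxE; case: eqP. Qed.

Lemma set_rowC i j u v A : i != j ->
  set_row i u (set_row j v A) = set_row j v (set_row i u A).
Proof.
by move=> ij; apply/matrixP => a b; rewrite !mxE;
  case: (altP (a =P i)) => [->|//]; rewrite (negbTE ij).
Qed.

Lemma set_row_id i A : set_row i (row i A) A = A.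
Proof. by apply/matrixP => a b; rewrite !mxE; case: eqP => [->|]. Qed.
End SetRow.

Lemma scale_row_diag (R : realType) (m d : nat) (i : 'I_m) (c : R)
    (A : 'M[R]_(m, d)) :
  set_row i (c *: row i A) A =
  diag_mx (\row_j (if j == i then c else 1)) *m A.
Proof.
apply/matrixP => a b; rewrite !mxE (bigD1 a)//= big1 => [|j ja]; last first.
  by rewrite !mxE [a == j]eq_sym (negbTE ja) mulr0n mul0r.
by rewrite !mxE eqxx mulr1n addr0; case: eqP => [->//|_]; rewrite mul1r.
Qed.

Lemma det_scale_diag (R : realType) (m : nat) (i : 'I_m) (c : R) :
  \det (diag_mx (\row_j (if j == i then c else 1))) = c.
Proof.
rewrite det_diag (bigD1 i)//= mxE eqxx big1 ?mulr1// => j ji.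
by rewrite mxE (negbTE ji).
Qed.

Section Multilinear.
Variables (R : realType) (m d : nat) (w : 'M[R]_(m, d) -> R).
Hypothesis hw : multilinear_alternating w.
Implicit Types (A : 'M[R]_(m, d)) (u v : 'rV[R]_d) (i j : 'I_m).

Lemma form_set_rowP i b c u v A :
  w (set_row i (b *: u + c *: v) A) =
  b * w (set_row i u A) + c * w (set_row i v A).
Proof. by apply: (hw.1 _ _ _ i); rewrite ?row_set_row// !row'_set_row. Qed.

Lemma form_set_rowZ i b u A : w (set_row i (b *: u) A) = b * w (set_row i u A).
Proof.
by have := form_set_rowP i b 0 u 0 A; rewrite mul0r scale0r !addr0.
Qed.

Lemma form_set_rowD i u v A :
  w (set_row i (u + v) A) = w (set_row i u A) + w (set_row i v A).
Proof. by have := form_set_rowP i 1 1 u v A; rewrite !scale1r !mul1r. Qed.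

Lemma form_set_row0 i A : w (set_row i 0 A) = 0.
Proof. by have := form_set_rowZ i 0 0 A; rewrite scale0r mul0r. Qed.

Lemma form_set_row_sum (I : finType) i (u : I -> 'rV[R]_d) A :
  w (set_row i (\sum_t u t) A) = \sum_t w (set_row i (u t) A).
Proof.
apply: (big_morph (fun x => w (set_row i x A)) (op1 := +%R)) => [x y|].
  exact: form_set_rowD.
exact: form_set_row0.
Qed.

Lemma form_dup i j u A : i != j -> w (set_row i u (set_row j u A)) = 0.
Proof.
move=> ij; apply: (hw.2 _ _ _ ij).
by rewrite row_set_row row_set_row_neq ?row_set_row// eq_sym.
Qed.

Lemma form_swap i j u v A : i != j ->
  w (set_row i u (set_row j v A)) = - w (set_row i v (set_row j u A)).
Proof.
move=> ij; have := form_dup (u + v) A ij.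
rewrite form_set_rowD !(set_rowC _ _ _ ij) !form_set_rowD.
rewrite -!(set_rowC _ _ _ ij) !form_dup// add0r addr0.
by move=> /eqP; rewrite addr_eq0 => /eqP.
Qed.

Lemma form_row_expand i v A :
  w (set_row i v A) = \sum_j v 0 j * w (set_row i (delta_mx 0 j) A).
Proof.
rewrite [in LHS](row_sum_delta v) form_set_row_sum.
by apply: eq_bigr => j _; rewrite form_set_rowZ.
Qed.
End Multilinear.

Lemma det_multilinear_alternating (R : realType) (m : nat) :
  multilinear_alternating (fun A : 'M[R]_m => \det A).
Proof.
split=> [A B C i0 b c|A i1 i2 i12 e]; first exact: determinant_multilinear.
apply: (determinant_alternate i12) => j.
by have /rowP/(_ j) := e; rewrite !mxE.
Qed.

(** Statements about [w A] are proved by freeing the rows of [A] one at a time: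
    the rows in [s] are those of [A], the others are constant. *)
Definition mix_rows (T : Type) (m d : nat) (s : seq 'I_m) (A C : 'M[T]_(m, d)) :
  'M[T]_(m, d) := \matrix_(a, b) if a \in s then A a b else C a b.

Lemma mix_rows_cons (T : Type) (m d : nat) i (s : seq 'I_m)
    (A C : 'M[T]_(m, d)) v : i \notin s ->
  set_row i v (mix_rows s A C) = mix_rows s A (set_row i v C).
Proof.
move=> is_; apply/matrixP => a b; rewrite !mxE.
by case: (altP (a =P i)) => [->|//]; rewrite (negbTE is_).
Qed.

Lemma mix_rowsE (T : Type) (m d : nat) i (s : seq 'I_m) (A C : 'M[T]_(m, d)) :
  mix_rows (i :: s) A C = set_row i (row i A) (mix_rows s A C).
Proof. by apply/matrixP => a b; rewrite !mxE in_cons; case: eqP => [->|]. Qed.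

Lemma mix_rows_enum (T : Type) (m d : nat) (A C : 'M[T]_(m, d)) :
  mix_rows (enum 'I_m) A C = A.
Proof. by apply/matrixP => a b; rewrite !mxE mem_enum. Qed.

(** Expanding one row after another in the standard basis writes the form as a
    polynomial in the entries of the frame, whose coefficients are the values of
    the form on constant frames. *)
Lemma continuous_form (R : realType) (X : topologicalType) (m d : nat)
    (phi : X -> 'M[R]_(m, d) -> R) (E : X -> 'M[R]_(m, d)) (x : X) :
  (forall y, multilinear_alternating (phi y)) ->
  (forall C, phi y C @[y --> x] --> phi x C) ->
  (forall i j, E y i j @[y --> x] --> E x i j) ->
  phi y (E y) @[y --> x] --> phi x (E x).
Proof.
move=> hphi cphi cE.
suff H s C : uniq s ->
    phi y (mix_rows s (E y) C) @[y --> x] --> phi x (mix_rows s (E x) C).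
  have := H (enum 'I_m) (E x) (enum_uniq _).
  by under eq_fun do rewrite mix_rows_enum; rewrite mix_rows_enum.
elim: s C => [|i s IH] C /=.
  have mix0 A : mix_rows [::] A C = C by apply/matrixP => a b; rewrite !mxE.
  by move=> _; under eq_fun do rewrite mix0; rewrite mix0; exact: cphi.
move=> /andP[is_ us].
have expand y : phi y (mix_rows (i :: s) (E y) C) = \sum_j E y i j *
   phi y (mix_rows s (E y) (set_row i (delta_mx 0 j) C)).
  rewrite mix_rowsE (form_row_expand (hphi y)).
  by apply: eq_bigr => j _; rewrite mix_rows_cons// mxE.
under eq_fun do rewrite expand.
rewrite expand; apply: cvg_big => [|j _]; first exact: add_continuous.
by apply: cvgM; [exact: cE|exact: IH].
Qed.

(** The product rule, one row at a time. *)
Lemma is_derive_form (R : realType) (m d : nat)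
    (w : 'M[R]_(m, d) -> R) (E : R -> 'M[R]_(m, d)) (E' : 'M[R]_(m, d)) (x : R) :
  multilinear_alternating w ->
  (forall i j, is_derive x 1 (fun y => E y i j) (E' i j)) ->
  is_derive x 1 (fun y => w (E y)) (\sum_i w (set_row i (row i E') (E x))).
Proof.
move=> hw dE.
suff H s C : uniq s -> is_derive x 1 (fun y => w (mix_rows s (E y) C))
    (\sum_(i <- s) w (set_row i (row i E') (mix_rows s (E x) C))).
  have := H (enum 'I_m) (E x) (enum_uniq _).
  under eq_fun do rewrite mix_rows_enum.
  by rewrite big_enum/= mix_rows_enum.
elim: s C => [|i s IH] C /=.
  move=> _; rewrite big_nil (_ : (fun y => _) = cst (w C)).
    exact: is_derive_cst.
  apply/funext => y; congr w; by apply/matrixP => a b; rewrite !mxE.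
move=> /andP[is_ us].
pose C_ j := set_row i (delta_mx 0 j) C.
rewrite (_ : (fun y => _) = \sum_j (fun y => E y i j) *
   (fun y => w (mix_rows s (E y) (C_ j)))); last first.
  apply/funext => y; rewrite mix_rowsE (form_row_expand hw) fct_sumE.
  by apply: eq_bigr => j _; rewrite mix_rows_cons// mxE.
rewrite (_ : \sum_(j <- _) _ = \sum_j (E x i j *: 
     (\sum_(l <- s) w (set_row l (row l E') (mix_rows s (E x) (C_ j)))) +
   w (mix_rows s (E x) (C_ j)) *: E' i j)).
  have dj j := is_deriveM (dE i j) (IH (C_ j) us).
  exact: is_derive_sum.
rewrite big_cons big_split/= addrC; congr (_ + _).
  rewrite mix_rowsE set_row_set_row (form_row_expand hw).
  by apply: eq_bigr => j _; rewrite mix_rows_cons// mxE mulrC.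
under [RHS]eq_bigr do rewrite -[_ *: _]/(_ * _) big_distrr/=.
rewrite exchange_big/= big_seq [RHS]big_seq; apply: eq_bigr => l ls.
have li : l != i by apply: contraNneq is_ => <-.
rewrite mix_rowsE (set_rowC _ _ _ li) (form_row_expand hw).
apply: eq_bigr => j _.
by rewrite [row _ _ _ _]mxE -(set_rowC _ _ _ li) (mix_rows_cons _ _ _ is_).
Qed.

Section Gram.
Variables (R : realType) (d : nat).

Lemma dotE (u v : 'rV[R]_d) : dot u v = \sum_j u 0 j * v 0 j.
Proof. by rewrite /dot mxE; apply: eq_bigr => j _; rewrite mxE. Qed.

Lemma dotC (u v : 'rV[R]_d) : dot u v = dot v u.
Proof. by rewrite !dotE; apply: eq_bigr => j _; rewrite mulrC. Qed.

Lemma dotDl (u v w : 'rV[R]_d) : dot (u + v) w = dot u w + dot v w.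
Proof. by rewrite /dot mulmxDl mxE. Qed.

Lemma dotZl a (u w : 'rV[R]_d) : dot (a *: u) w = a * dot u w.
Proof. by rewrite /dot -scalemxAl mxE. Qed.

Lemma dotDr (u v w : 'rV[R]_d) : dot w (u + v) = dot w u + dot w v.
Proof. by rewrite !(dotC w) dotDl. Qed.

Lemma dotZr a (u w : 'rV[R]_d) : dot w (a *: u) = a * dot w u.
Proof. by rewrite !(dotC w) dotZl. Qed.

Lemma dot_sumr (I : finType) (u : I -> 'rV[R]_d) v :
  dot v (\sum_i u i) = \sum_i dot v (u i).
Proof.
apply: (big_morph (dot v) (op1 := +%R)) => [x y|]; first exact: dotDr.
by rewrite dotC /dot mul0mx mxE.
Qed.

Lemma dot_gt0 (u : 'rV[R]_d) : u != 0 -> 0 < dot u u.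
Proof.
move=> u0; rewrite dotE lt_neqAle sumr_ge0 ?andbT; last first.
  by move=> j _; rewrite -expr2 sqr_ge0.
apply: contraNneq u0 => /esym/eqP.
rewrite psumr_eq0 => [/allP h|j _]; last by rewrite -expr2 sqr_ge0.
apply/eqP/rowP => j; rewrite mxE; apply/eqP.
by have := h j (mem_index_enum _); rewrite mulf_eq0 orbb.
Qed.

Lemma gram_dot m (E : 'M[R]_(m, d)) i j :
  (E *m E^T) i j = dot (row i E) (row j E).
Proof. by rewrite dotE mxE; apply: eq_bigr => b _; rewrite !mxE. Qed.

Lemma gram_unitmx m (E : 'M[R]_(m, d)) : row_free E -> E *m E^T \in unitmx.
Proof.
move=> Efree; rewrite -row_free_unit -kermx_eq0.
apply/eqP/row_matrixP => i; rewrite row0.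
set u := row i _.
have u0 : u *m (E *m E^T) = 0.
  by apply/sub_kermxP; rewrite row_sub.
have uE : u *m E = 0.
  apply/eqP/negP => /negP /dot_gt0.
  by rewrite /dot trmx_mul mulmxA -(mulmxA u) u0 mul0mx mxE ltxx.
by apply: (row_free_inj Efree); rewrite uE mul0mx.
Qed.

(** Gram-Schmidt on the first vector: replacing it by its component orthogonal
    to the others is a unipotent row operation, which splits off a positive
    factor of the determinant. *)
Lemma gram_gt0 m (E : 'M[R]_(m, d)) : row_free E -> 0 < \det (E *m E^T).
Proof.
elim: m E => [|m IH] E; first by rewrite det_mx00.
move: E; rewrite -[m.+1]/(1 + m)%N => E; rewrite -(vsubmxK E).
move: (usubmx E) (dsubmx E) => v F vF.
have Ffree : row_free F.
  rewrite -kermx_eq0; apply/eqP/row_matrixP => i; rewrite row0.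
  have /eqP : row_mx (0 : 'rV_1) (row i (kermx F)) *m col_mx v F = 0.
    by rewrite mul_row_col mul0mx add0r -row_mul mulmx_ker row0.
  rewrite mulmx_free_eq0// => /eqP.
  by move=> /(congr1 rsubmx); rewrite row_mxKr => ->; apply/rowP => j; rewrite !mxE.
have GF := gram_unitmx Ffree.
pose a := v *m F^T *m invmx (F *m F^T).
pose U : 'M[R]_(1 + m) := block_mx 1%:M (- a) 0 1%:M.
have detU : \det U = 1 by rewrite det_ublock !det1 mulr1.
pose v' := v - a *m F.
have UE : U *m col_mx v F = col_mx v' F.
  by rewrite mul_block_col !mul1mx mul0mx add0r mulNmx.
have v'F : v' *m F^T = 0.
  by rewrite mulmxBl -[a *m F *m _]mulmxA mulmxKV// subrr.
have v'0 : v' != 0.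
  apply/eqP => v'0.
  have /eqP : row_mx (1%:M : 'rV_1) (- a) *m col_mx v F = 0.
    by rewrite mul_row_col mul1mx mulNmx.
  rewrite mulmx_free_eq0// => /eqP /(congr1 lsubmx).
  rewrite row_mxKl => /matrixP/(_ 0 0); rewrite !mxE/= => /eqP.
  by rewrite oner_eq0.
have -> : \det (col_mx v F *m (col_mx v F)^T) =
    \det (col_mx v' F *m (col_mx v' F)^T).
  by rewrite -UE trmx_mul -mulmxA (mulmxA (col_mx v F)) !det_mulmx det_tr detU
    mul1r mulr1.
rewrite tr_col_mx mul_col_row v'F.
rewrite det_lblock mulr_gt0 ?IH//.
by rewrite det_mx11 dot_gt0.
Qed.

Lemma gram_scale_row m (E : 'M[R]_(m, d)) i c :
  \det (set_row i (c *: row i E) E *m (set_row i (c *: row i E) E)^T) =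
  c ^+ 2 * \det (E *m E^T).
Proof.
rewrite scale_row_diag trmx_mul -mulmxA (mulmxA E) !det_mulmx det_tr.
by rewrite det_scale_diag expr2 mulrCA mulrC.
Qed.

(** By orthogonality [s] enters the Gram matrix through the entry [(i, i)] only,
    as [s ^+ 2 * dot y y]; in particular there is no term linear in [s]. *)
Lemma gram_set_row_orth m (E : 'M[R]_(m, d)) i (y : 'rV[R]_d) :
  (forall j, dot y (row j E) = 0) ->
  exists C, forall s,
    \det (set_row i (row i E + s *: y) E *m (set_row i (row i E + s *: y) E)^T)
    = \det (E *m E^T) + s ^+ 2 * C.
Proof.
move=> yE; pose G := E *m E^T.
exists (dot y y * \det (set_row i (delta_mx 0 i) G)) => s.
set E' := set_row i _ _.
have -> : E' *m E'^T = set_row i (1 *: row i G + (s ^+ 2 * dot y y) *: delta_mx 0 i) G.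
  apply/matrixP => a b; rewrite gram_dot !mxE.
  case: (altP (a =P i)) => [->|ai].
    rewrite row_set_row; case: (altP (b =P i)) => [->|bi].
      rewrite row_set_row !dotDr !dotDl !dotZl !dotZr yE (dotC _ y) yE -gram_dot.
      by rewrite /G /= !mxE; ring.
    rewrite row_set_row_neq// dotDl dotZl yE -gram_dot /G mxE/= mulr0 addr0.
    by rewrite mulr0 addr0 mul1r.
  rewrite row_set_row_neq//; case: (altP (b =P i)) => [->|bi].
    by rewrite row_set_row dotDr dotZr (dotC _ y) yE mulr0 addr0 -gram_dot /G mxE.
  by rewrite row_set_row_neq// -gram_dot /G mxE.
rewrite (form_set_rowP (det_multilinear_alternating R m)) set_row_id mul1r.
by rewrite mulrA.
Qed.
End Gram.

(** The first cousin principle: a form bounded by the volume is stationary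
    where it attains the volume, so tilting one vector of the frame into an
    orthogonal direction does not change the value to first order. *)
Lemma first_cousin (R : realType) (m d : nat) (w : 'M[R]_(m, d) -> R)
    (E : 'M[R]_(m, d)) (i : 'I_m) (y : 'rV[R]_d) :
  multilinear_alternating w ->
  (forall F, 0 < \det (F *m F^T) -> w F ^+ 2 <= \det (F *m F^T)) ->
  0 < \det (E *m E^T) -> w E ^+ 2 = \det (E *m E^T) ->
  (forall j, dot y (row j E) = 0) ->
  w (set_row i y E) = 0.
Proof.
move=> hw wle E0 wE yE.
have [C hC] := gram_set_row_orth i yE.
set a := w (set_row i y E); set g := \det _ in E0 wE hC.
have wEs s : w (set_row i (row i E + s *: y) E) = w E + s * a.
  by rewrite -[in LHS](scale1r (row i E)) (form_set_rowP hw) set_row_id mul1r.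
pose D : R := `|C| + 1.
have D0 : 0 < D by rewrite ltr_wpDl.
have C_D : `|C| <= D by rewrite lerDl.
(* Compare [w ^+ 2] with the squared volume on the frames tilted by [t] and by
   [- t]; the bound on [t] keeps these frames free. *)
have key (t : R) : 0 < t -> t <= 1 -> t ^+ 2 * D < g ->
    2 * w E * a * t <= t ^+ 2 * D /\ - (2 * w E * a * t) <= t ^+ 2 * D.
  move=> t0 t1 tD.
  have tC : - (t ^+ 2 * D) <= t ^+ 2 * C <= t ^+ 2 * D.
    by rewrite -ler_norml normrM (ger0_norm (sqr_ge0 _)) ler_wpM2l ?sqr_ge0.
  have a2 : 0 <= t ^+ 2 * a ^+ 2 by rewrite mulr_ge0 ?sqr_ge0.
  have h s : s ^+ 2 = t ^+ 2 -> (w E + s * a) ^+ 2 <= g + t ^+ 2 * C.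
    move=> st; rewrite -st -hC -wEs wle// hC st; move: tC => /andP[? _]; lra.
  have h1 := h t erefl; have h2 := h (- t) (sqrrN _).
  move: tC h1 h2 => /andP[? ?]; rewrite -wE !sqrrD.
  by split; nra.
have [//|a0] := eqVneq a 0.
have wE0 : w E != 0 by rewrite -sqrf_eq0 wE gt_eqF.
pose b : R := `|2 * w E * a|.
have b0 : 0 < b by rewrite normr_gt0 !mulf_neq0// pnatr_eq0.
have keyb (t : R) : 0 < t -> t <= 1 -> t ^+ 2 * D < g -> b * t <= t ^+ 2 * D.
  move=> t0 t1 tD; have [k1 k2] := key t t0 t1 tD.
  have [h|h] := leP 0 (2 * w E * a); first by rewrite /b ger0_norm.
  by rewrite /b ltr0_norm// mulNr.
pose t : R := Num.min 1 (Num.min (g / (2 * D)) (b / (2 * D))).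
have t0 : 0 < t by rewrite !lt_min ltr01 !divr_gt0 ?mulr_gt0.
have t1 : t <= 1 by rewrite ge_min lexx.
have tg : t <= g / (2 * D) by rewrite !ge_min lexx !orbT.
have tb : t <= b / (2 * D) by rewrite !ge_min lexx !orbT.
rewrite ler_pdivlMr ?mulr_gt0// in tg; rewrite ler_pdivlMr ?mulr_gt0// in tb.
have tD : t ^+ 2 * D < g by nra.
have := keyb t t0 t1 tD; nra.
Qed.

(** * Positive Hausdorff measure of expanding images of cubes *)

Lemma norm_coord (R : realType) m d (v : 'M[R]_(m, d)) i j : `|v i j| <= `|v|.
Proof.
by rewrite [leRHS]/Num.Def.normr/= mx_normrE; exact: (le_bigmax _ _ (i, j)).
Qed.

Lemma norm_mx_le (R : realType) m d (v : 'M[R]_(m, d)) c :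
  0 <= c -> (forall i j, `|v i j| <= c) -> `|v| <= c.
Proof.
by move=> c0 h; rewrite [leLHS]/Num.Def.normr/= mx_normrE bigmax_le// => -[i j] _.
Qed.

Definition unit_cube (R : realType) (m : nat) : set 'rV[R]_m :=
  [set x | forall j, 0 <= x 0 j <= 1].

(** In each direction the points of [X] range over an interval of integers of
    length at most [M c]. *)
Lemma grid_count (R : realType) (m M : nat) (c : R)
    (X : {set {ffun 'I_m -> 'I_M}}) :
  0 <= c -> (forall u v i, u \in X -> v \in X -> (u i)%:R - (v i)%:R <= M%:R * c) ->
  (#|X|%:R : R) <= (M%:R * c + 1) ^+ m.
Proof.
move=> c0 hX; have [->|[u0 u0X]] := set_0Vmem X.
  by rewrite cards0 exprn_ge0// addr_ge0// mulr_ge0.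
pose A i : {set 'I_M} := [set (u : {ffun 'I_m -> 'I_M}) i | u in X]%SET.
have cardA i : (#|A i|%:R : R) <= M%:R * c + 1.
  have Ai0 : u0 i \in A i by apply: imset_f.
  case: (arg_minnP (fun x : 'I_M => val x) Ai0) => lo /imsetP[v vX ->] lomin.
  pose n := Num.truncn (M%:R * c).
  have nM : n%:R <= M%:R * c by rewrite truncn_le// mulr_ge0.
  have sub : {subset [seq val x | x <- enum (A i)] <= iota (v i) n.+1}.
    move=> y /mapP[x]; rewrite mem_enum => xA -> {y}; rewrite mem_iota lomin//= addnS.
    rewrite ltnS -leq_subLR truncn_ge_nat ?mulr_ge0// natrB ?lomin//.
    by move/imsetP: xA => [w wX ->]; exact: hX.
  rewrite (le_trans _ (_ : n.+1%:R <= _))//; last by rewrite -natr1 lerD2r.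
  rewrite ler_nat cardE -(size_map val) -[leqRHS](size_iota (v i)).
  by apply: uniq_leq_size => //; rewrite map_inj_uniq ?enum_uniq//; exact: val_inj.
have XA : X \subset family (fun i => mem (A i)).
  by apply/fintype.subsetP => u uX; apply/familyP => i; exact: imset_f.
rewrite (le_trans (_ : _ <= (\prod_i #|A i|)%N%:R))//.
  rewrite ler_nat (leq_trans (subset_leq_card XA))// card_family.
  by rewrite foldrE big_map big_enum.
rewrite natr_prod -[m in leRHS](card_ord m) -prodr_const.
by apply: ler_prod => i _; rewrite ler0n cardA.
Qed.

(** Volume is replaced by the number of points of a grid, so fine that the
    rounding error [1] in [grid_count] is at most [M * c i]. *)
Lemma grid_cover (R : realType) (m n : nat) (O : nat -> set 'rV[R]_m)
    (c : nat -> R) :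
  (forall i, 0 < c i) ->
  (forall i u v, O i u -> O i v -> `|u - v| <= c i) ->
  (forall x : 'rV[R]_m, unit_cube x -> exists2 i, (i < n)%N & O i x) ->
  1 <= \sum_(i < n) (2 * c i) ^+ m.
Proof.
move=> c0 Oc cov.
pose M := (Num.truncn (\sum_(i < n) (c i)^-1)).+1.
have M0 : 0 < M%:R :> R by rewrite ltr0n.
have Mc (i : 'I_n) : 1 <= M%:R * c i.
  rewrite -ler_pdivrMr// mul1r ltW// (le_lt_trans _ (truncnS_gt _))//.
  rewrite (bigD1 i)//= lerDl sumr_ge0// => j _.
  by rewrite invr_ge0 ltW.
pose p (v : {ffun 'I_m -> 'I_M}) : 'rV[R]_m := \row_j ((v j)%:R / M%:R).
have pcube v : unit_cube (p v).
  move=> j; rewrite mxE divr_ge0//= ler_pdivrMr// mul1r ler_nat ltnW//.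
pose X (i : 'I_n) := [set v | `[< O i (p v) >]]%SET.
have memX i v : (v \in X i) = `[< O i (p v) >] by rewrite finset.in_set.
have cardX i : (#|X i|%:R : R) <= (M%:R * c i + 1) ^+ m.
  apply: grid_count => [|u v j]; first exact: ltW.
  rewrite !memX => /asboolP Ou /asboolP Ov.
  have := Oc _ _ _ Ou Ov => /(le_trans (norm_coord _ 0 j)).
  rewrite !mxE -mulrBl => /(le_trans (ler_norm _)).
  by rewrite ler_pdivrMr// mulrC.
have cardT : ((M ^ m)%N%:R : R) <= \sum_(i < n) #|X i|%:R.
  rewrite -natr_sum ler_nat -[M in leqLHS]card_ord -[m in leqLHS]card_ord.
  rewrite -card_ffun -sum1_card.
  rewrite (eq_bigr (fun i => \sum_(v | v \in X i) 1)%N) => [|i _]; last first.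
    by rewrite sum1_card.
  rewrite (exchange_big_dep predT)//=; apply: leq_sum => v _.
  have [i lin Oi] := cov _ (pcube v).
  by rewrite (bigD1 (Ordinal lin)) ?memX//=; apply/asboolP.
have : (M%:R ^+ m : R) <= M%:R ^+ m * \sum_(i < n) (2 * c i) ^+ m.
  rewrite -natrX (le_trans cardT)// natrX mulr_sumr; apply: ler_sum => i _.
  rewrite (le_trans (cardX i))// -exprMn lerXn2r ?nnegrE//.
  - by rewrite addr_ge0// mulr_ge0// ltW.
  - by rewrite !mulr_ge0// ltW.
  - by have := Mc i; lra.
by rewrite -[leLHS]mulr1 ler_pM2l// exprn_gt0.
Qed.

(** Enlarging the set of index [i] by [h i] makes it open, and compactness leaves
    finitely many sets, to which [grid_cover] applies. *)
Lemma cube_cover (R : realType) (m : nat) (S : nat -> set 'rV[R]_m)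
    (c : nat -> R) (B : R) :
  (0 < m)%N ->
  (forall i, 0 <= c i) ->
  (forall i u v, S i u -> S i v -> `|u - v| <= c i) ->
  (forall x : 'rV[R]_m, unit_cube x -> exists i, S i x) ->
  (forall n, \sum_(i < n) c i ^+ m <= B) ->
  1 <= 2 * 4 ^+ m * B.
Proof.
move=> m0 c0 Sc cov cB.
(* The enlargements contribute at most [4 ^+ m * e = 1 / 2] to the bound. *)
pose e : R := (2 * 4 ^+ m)^-1.
have e0 : 0 < e by rewrite invr_gt0 mulr_gt0// exprn_gt0.
have e1 : e <= 1.
  rewrite invf_le1 ?mulr_gt0 ?exprn_gt0//.
  by rewrite -[leLHS]mulr1 ler_pM// ?exprn_ege1// ler1n.
pose h i : R := e / 2 ^+ i.+1.
have h0 i : 0 < h i by rewrite divr_gt0// exprn_gt0.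
have h1 i : h i <= 1.
  by rewrite ler_pdivrMr ?exprn_gt0// mul1r (le_trans e1)// exprn_ege1// ler1n.
have sumh n : \sum_(i < n) h i <= e.
  rewrite (_ : \sum_(i < n) h i = e - e / 2 ^+ n).
    by rewrite gerBl divr_ge0// ?exprn_ge0// ltW.
  elim: n => [|n IH]; first by rewrite big_ord0 expr0 divr1 subrr.
  rewrite big_ord_recr/= IH /h exprS; field.
  by rewrite expf_neq0// pnatr_eq0.
pose O i : set 'rV[R]_m := \bigcup_(s in S i) ball s (h i / 2).
have Oop i : open (O i).
  by apply: bigcup_open => s _; exact: ball_open.
have OS i u v : O i u -> O i v -> `|u - v| <= c i + h i.
  move=> [s Ss]; rewrite -ball_normE /= => su [t St]; rewrite -ball_normE /= => tv.
  have st := Sc _ _ _ Ss St.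
  rewrite (_ : u - v = (s - t) - (s - u) + (t - v)); last first.
    by rewrite opprB [s - t + _]addrC [u - s + _]addrA subrK [RHS]addrA subrK.
  rewrite (le_trans (ler_normD _ _))// (le_trans (lerD (ler_normB _ _) (lexx _)))//.
  by move: (ltW su) (ltW tv) st; lra.
have ccube := @rV_compact R m (fun=> `[(0 : R), 1]%classic)
  (fun=> @segment_compact R 0 1).
rewrite compact_cover in ccube.
have [||D _ Dcov] := ccube nat setT O.
- by move=> i _; exact: Oop.
- move=> x /= xc.
  have [|i Sx] := cov x; first by move=> j; have := xc j; rewrite /= in_itv.
  by exists i => //; exists x => //; apply: ballxx; rewrite divr_gt0.
pose n := (\max_(i <- finmap.enum_fset D) i).+1.
have := @grid_cover R m n O (fun i => c i + h i) _ OS.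
move=> /(_ (fun i => ltr_wpDl (c0 i) (h0 i))).
have covn (x : 'rV[R]_m) : unit_cube x -> exists2 i, (i < n)%N & O i x.
  move=> xc; have [|i Di Ox] := Dcov x.
    by move=> j /=; rewrite in_itv/=; exact: xc.
  exists i => //; rewrite ltnS.
  exact: (@leq_bigmax_seq _ _ xpredT id).
move=> /(_ covn) le1.
have le_pow (x y : R) : 0 <= x -> x <= y -> x ^+ m <= y ^+ m.
  by move=> x0 xy; rewrite lerXn2r ?nnegrE// (le_trans x0).
have : 1 <= 4 ^+ m * (\sum_(i < n) c i ^+ m + \sum_(i < n) h i).
  rewrite (le_trans le1)// -big_split/= mulr_sumr; apply: ler_sum => i _.
  rewrite (_ : 4 = 2 * 2 :> R); last by rewrite -natrM.
  rewrite !exprMn -mulrA; rewrite ler_pM2l ?exprn_gt0//.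
  have hm : h i ^+ m <= h i.
    by rewrite -[leRHS]expr1 ler_wiXn2l// ltW.
  apply: (@le_trans _ _ (2 ^+ m * (c i ^+ m + h i ^+ m))); last first.
    by rewrite ler_pM2l ?exprn_gt0// lerD2l.
  have [ch|hc] := leP (c i) (h i).
    rewrite (@le_trans _ _ ((2 * h i) ^+ m))//.
      by apply: le_pow; move: (c0 i) (h0 i) ch; lra.
    by rewrite exprMn ler_pM2l ?exprn_gt0// lerDr exprn_ge0.
  rewrite (@le_trans _ _ ((2 * c i) ^+ m))//.
    by apply: le_pow; move: (c0 i) (h0 i) hc; lra.
  by rewrite exprMn ler_pM2l ?exprn_gt0// lerDl exprn_ge0// ltW.
have m4 : 0 < 4 ^+ m :> R by rewrite exprn_gt0.
move=> h4.
have : 1 <= 4 ^+ m * (B + e).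
  by rewrite (le_trans h4)// ler_pM2l// lerD// cB.
have : 4 ^+ m * e = 2^-1.
  by rewrite /e; field; rewrite gt_eqF.
rewrite mulrDr => ->; rewrite -mulrA; set X := 4 ^+ m * B; lra.
Qed.

Lemma norm_le_sqrt_dot (R : realType) d (v : 'rV[R]_d) :
  `|v| <= Num.sqrt (dot v v).
Proof.
apply: norm_mx_le => [|i j]; first exact: sqrtr_ge0.
rewrite ord1 -sqrtr_sqr ler_wsqrtr// dotE (bigD1 j)//= -expr2 lerDl.
by apply: sumr_ge0 => l _; rewrite -expr2 sqr_ge0.
Qed.

(** The preimage under [G] of a set of diameter [c] has diameter at most [K c],
    so a cover of [A] pulls back to a cover of the cube. *)
Lemma hausdorff_expanding (R : realType) (m d : nat) (A : set 'rV[R]_d)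
    (G : 'rV[R]_m -> 'rV[R]_d) (K : R) :
  (0 < m)%N -> 0 < K ->
  (forall x, unit_cube x -> A (G x)) ->
  (forall x y, unit_cube x -> unit_cube y -> `|x - y| <= K * `|G x - G y|) ->
  hausdorff m A <> 0%E.
Proof.
move=> m0 K0 GA Gexp HA.
have : (hausdorff_delta m 1 A <= 0)%E.
  by rewrite -HA; apply: ereal_sup_ubound; exists 1 => //=.
(* A cover of [A] with sum below [e] makes [cube_cover] read [1 <= 1 / 2]. *)
pose e : R := (2 * (2 * 4 ^+ m * K ^+ m))^-1.
have P0 : 0 < 2 * 4 ^+ m * K ^+ m by rewrite !mulr_gt0// exprn_gt0.
have e0 : 0 < e by rewrite invr_gt0 mulr_gt0.
move=> /le_lt_trans/(_ (_ : 0 < e%:E)%E); rewrite lte_fin => /(_ e0).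
move=> /ereal_inf_lt[_ [U [AU dU] <-]] Ue.
have d0 i : (0 <= diameter (U i))%E by apply: ereal_sup_ubound; left.
have dfin i : diameter (U i) \is a fin_num.
  by rewrite ge0_fin_numE// (le_lt_trans (dU i))// ltry.
pose c i := K * fine (diameter (U i)).
pose S i := [set x | unit_cube x /\ U i (G x)].
have S_c i u v : S i u -> S i v -> `|u - v| <= c i.
  move=> [cu Uu] [cv Uv]; rewrite (le_trans (Gexp _ _ cu cv))// ler_pM2l//.
  rewrite (le_trans (norm_le_sqrt_dot _))// -lee_fin fineK//.
  by apply: ereal_sup_ubound; right; exists (G u, G v).
have := @cube_cover R m S c (K ^+ m * e) m0 _ S_c.
have c0 i : 0 <= c i by apply: mulr_ge0; [exact: ltW|exact/fine_ge0].
have cov (x : 'rV[R]_m) : unit_cube x -> exists i, S i x.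
  by move=> xc; have [i _ Ui] := AU _ (GA _ xc); exists i.
move=> /(_ c0 cov) h.
have : 1 <= 2 * 4 ^+ m * (K ^+ m * e).
  apply: h => n.
  under eq_bigr do rewrite exprMn.
  rewrite -mulr_sumr ler_pM2l ?exprn_gt0// -lee_fin.
  apply: le_trans (ltW Ue).
  have := @nneseries_lim_ge R (fun i => diameter (U i) ^+ m)%E xpredT 0%N n.
  rewrite big_mkord -sumEFin.
  have -> : (\sum_(i < n) (fine (diameter (U i)) ^+ m)%:E =
      \sum_(i < n) diameter (U i) ^+ m)%E.
    by apply: eq_bigr => i _; rewrite EFin_expe fineK.
  by apply => i _ _; rewrite expe_ge0.
rewrite mulrA (_ : _ * e = 2^-1); last first.
  by rewrite /e invfM mulrCA mulfV ?mulr1// gt_eqF.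
by lra.
Qed.

(** * Differential calculus in a chart *)

Section Line.
Variables (R : realType) (V W : normedModType R).

Lemma is_derive_line (f : V -> W) (x v : V) (t : R) (l : W) :
  is_derive (x + t *: v) v f l ->
  is_derive t 1 (fun s : R => f (x + s *: v)) l.
Proof.
move=> [df dfl].
have E : (fun h : R => h^-1 *: (((fun s : R => f (x + s *: v)) \o shift t) (h *: 1)
    - f (x + t *: v))) =
  (fun h => h^-1 *: ((f \o shift (x + t *: v)) (h *: v) - f (x + t *: v))).
  apply/funext => h /=; congr (_ *: (f _ - _)).
  by rewrite scalerDl -[h *: 1]/(h * 1) mulr1 addrCA.
split; first by rewrite /derivable E.
by rewrite /derive E.
Qed.

Lemma is_derive_line0 (f : V -> W) (x v : V) (l : W) :
  is_derive x v f l -> is_derive (0 : R) 1 (fun s : R => f (x + s *: v)) l.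
Proof. by move=> df; apply: is_derive_line; rewrite scale0r addr0. Qed.

Lemma near_line (U : set V) (x v : V) : open U -> U x ->
  \forall t \near (0 : R), U (x + t *: v).
Proof.
move=> Uop Ux.
have : (fun t : R => x + t *: v) @ 0 --> x + 0 *: v.
  by apply: cvgD; [exact: cvg_cst|apply: cvgZr_tmp].
rewrite scale0r addr0 => /(_ U); apply.
exact: open_nbhs_nbhs.
Qed.
End Line.

Section Coordinates.
Variables (R : realType) (V : normedModType R) (d : nat).

Lemma is_derive_coord (f : V -> 'rV[R]_d) x v j :
  derivable f x v -> is_derive x v (fun y => f y 0 j) (('D_v f x) 0 j).
Proof.
move=> df; have dfj := (derivable_mxP f x v).1 df 0 j.
by split=> //; rewrite derive_mx// mxE.
Qed.
End Coordinates.

(** Mean value theorem, twice, on the second difference of [g] over the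
    parallelogram with sides [s u] and [s v]: first along [u], then along [v]. *)
Lemma second_difference (R : realType) (V : normedModType R)
    (g gu guv : V -> R) (p u v : V) (s : R) :
  0 < s ->
  (forall a b : R, 0 <= a <= s -> 0 <= b <= s ->
    is_derive (p + a *: u + b *: v) u g (gu (p + a *: u + b *: v))) ->
  (forall a b : R, 0 <= a <= s -> 0 <= b <= s ->
    is_derive (p + a *: u + b *: v) v gu (guv (p + a *: u + b *: v))) ->
  exists a b : R, [/\ 0 <= a <= s, 0 <= b <= s &
    g (p + s *: u + s *: v) - g (p + s *: u) - (g (p + s *: v) - g p) =
    s ^+ 2 * guv (p + a *: u + b *: v)].
Proof.
move=> s0 dg dgu.
have s0s : 0 <= s <= s by rewrite lexx ltW.
have z0s : 0 <= (0 : R) <= s by rewrite lexx ltW.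
pose F a := g (p + a *: u + s *: v) - g (p + a *: u).
have dline b a : 0 <= a <= s -> 0 <= b <= s ->
    is_derive a 1 (fun a => g (p + a *: u + b *: v)) (gu (p + a *: u + b *: v)).
  move=> a0 b0; have h := dg a b a0 b0; rewrite addrAC in h.
  have := is_derive_line h.
  by under eq_fun do rewrite addrAC; rewrite addrAC.
have dF a : 0 <= a <= s ->
    is_derive a 1 F (gu (p + a *: u + s *: v) - gu (p + a *: u)).
  move=> a0; apply: is_deriveB; first exact: dline.
  have := dline 0 a a0 z0s.
  by under eq_fun do rewrite scale0r addr0; rewrite scale0r addr0.
have [a a0s Fa] : exists2 a, a \in `]0, s[%R &
    F s - F 0 = (gu (p + a *: u + s *: v) - gu (p + a *: u)) * (s - 0).
  apply: (@MVT _ F (fun a => gu (p + a *: u + s *: v) - gu (p + a *: u))) => //.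
    by move=> x; rewrite in_itv/= => /andP[x0 xs]; apply: dF; rewrite !ltW.
  apply: derivable_within_continuous => x; rewrite in_itv/= => x0s.
  by have [] := dF x x0s.
have a0 : 0 <= a <= s by move: a0s; rewrite in_itv/= => /andP[? ?]; rewrite !ltW.
pose H b := gu (p + a *: u + b *: v).
have dH b : 0 <= b <= s -> is_derive b 1 H (guv (p + a *: u + b *: v)).
  by move=> b0; exact: is_derive_line (dgu a b a0 b0).
have [b b0s Hb] : exists2 b, b \in `]0, s[%R &
    H s - H 0 = guv (p + a *: u + b *: v) * (s - 0).
  apply: (@MVT _ H (fun b => guv (p + a *: u + b *: v))) => //.
    by move=> x; rewrite in_itv/= => /andP[x0 xs]; apply: dH; rewrite !ltW.
  apply: derivable_within_continuous => x; rewrite in_itv/= => x0s.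
  by have [] := dH x x0s.
have b0 : 0 <= b <= s by move: b0s; rewrite in_itv/= => /andP[? ?]; rewrite !ltW.
exists a, b; split=> //.
move: Fa Hb; rewrite /F /H !scale0r !addr0 !subr0 => -> ->.
by rewrite expr2; ring.
Qed.

(** The second difference is symmetric in [u] and [v], and [second_difference]
    evaluates it in both orders, at points that tend to [p] with [s]. *)
Lemma schwarz (R : realType) (V : normedModType R)
    (g gu gv guv gvu : V -> R) (U : set V) (p u v : V) :
  open U -> U p ->
  (forall x, U x -> is_derive x u g (gu x)) ->
  (forall x, U x -> is_derive x v g (gv x)) ->
  (forall x, U x -> is_derive x v gu (guv x)) ->
  (forall x, U x -> is_derive x u gv (gvu x)) ->
  {for p, continuous guv} -> {for p, continuous gvu} ->
  guv p = gvu p.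
Proof.
move=> Uop Up dgu dgv dguv dgvu cuv cvu.
apply/eqP/negP => /negP ne.
pose e := `|guv p - gvu p| / 2.
have e0 : 0 < e by rewrite divr_gt0// normr_gt0 subr_eq0.
have : \forall x \near p, [/\ U x, `|guv p - guv x| < e & `|gvu p - gvu x| < e].
  near=> x; split; near: x; first exact: open_nbhs_nbhs.
    by move/cvgrPdist_lt : cuv; exact.
  by move/cvgrPdist_lt : cvu; exact.
move=> /nbhs_ballP[r /= r0 Hr].
pose s := r / (2 * (`|u| + `|v| + 1)).
have D0 : 0 < `|u| + `|v| + 1 by rewrite ltr_wpDl// addr_ge0.
have s0 : 0 < s by rewrite divr_gt0// mulr_gt0.
have inU (a b : R) : 0 <= a <= s -> 0 <= b <= s ->
    [/\ U (p + a *: u + b *: v), `|guv p - guv (p + a *: u + b *: v)| < e &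
      `|gvu p - gvu (p + a *: u + b *: v)| < e].
  move=> /andP[a0 as_] /andP[b0 bs].
  apply: Hr; rewrite -ball_normE /ball_/= -addrA opprD addrA subrr sub0r normrN.
  rewrite (le_lt_trans (ler_normD _ _))// !normrZ !ger0_norm//.
  have : s * (2 * (`|u| + `|v| + 1)) = r by rewrite divfK// gt_eqF// mulr_gt0.
  have := normr_ge0 u; have := normr_ge0 v.
  move: as_ bs; nra.
have inU' (a b : R) : 0 <= a <= s -> 0 <= b <= s -> U (p + a *: u + b *: v).
  by move=> a0 b0; have [] := inU a b a0 b0.
have [a [b [a0 b0 E1]]] := @second_difference _ _ g gu guv p u v s s0
  (fun a b a0 b0 => dgu _ (inU' a b a0 b0))
  (fun a b a0 b0 => dguv _ (inU' a b a0 b0)).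
have inV (a1 b1 : R) : 0 <= a1 <= s -> 0 <= b1 <= s -> U (p + a1 *: v + b1 *: u).
  by move=> ? ?; rewrite addrAC; exact: inU'.
have [b' [a' [b'0 a'0 E2]]] := @second_difference _ _ g gv gvu p v u s s0
  (fun a b a0 b0 => dgv _ (inV a b a0 b0))
  (fun a b a0 b0 => dgvu _ (inV a b a0 b0)).
have [_ e1 _] := inU _ _ a0 b0; have [_ _] := inU _ _ a'0 b'0.
rewrite (addrAC p (a' *: u)).
have <- : guv (p + a *: u + b *: v) = gvu (p + b' *: v + a' *: u).
  apply: (@mulfI _ (s ^+ 2)); first by rewrite gt_eqF// exprn_gt0.
  rewrite -E1 -E2 (addrAC p (s *: v)); ring.
set c := guv (_ + _) in e1 *; move=> e2.
have : `|guv p - gvu p| < e + e.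
  rewrite (_ : guv p - gvu p = (guv p - c) - (gvu p - c)); last by ring.
  by rewrite (le_lt_trans (ler_normB _ _))// ltrD.
by rewrite /e -splitr ltxx.
Unshelve. all: by end_near. Qed.

Lemma derive_coord_expand (R : realType) (W : normedModType R) (d : nat)
    (f : 'rV[R]_d -> W) x (v : 'rV[R]_d) :
  differentiable f x -> 'D_v f x = \sum_j v 0 j *: 'D_(delta_mx 0 j) f x.
Proof.
move=> df; rewrite deriveE// [in LHS](row_sum_delta v) linear_sum.
by apply: eq_bigr => j _; rewrite linearZ -deriveE.
Qed.

(** Mean value theorem along segments, in a ball where every partial derivative
    stays within distance 1 of its value at [p]. *)
Lemma C1_lipschitz (R : realType) (d e : nat) (U : set 'rV[R]_d)
    (f : 'rV[R]_d -> 'rV[R]_e) (p : 'rV[R]_d) :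
  open U -> U p -> Ck_on U 1 f ->
  exists r K : R, [/\ 0 < r, 0 < K & forall x y, `|x - p| < r -> `|y - p| < r ->
    `|f x - f y| <= K * `|x - y| ].
Proof.
move=> Uop Up [fd fc].
have : \forall x \near p, U x /\
    forall j, `|'D_(delta_mx 0 j) f x| <= `|'D_(delta_mx 0 j) f p| + 1.
  near=> x; split; near: x; first exact: open_nbhs_nbhs.
  apply: filter_forall => j.
  have /cvgrPdist_lt/(_ 1 ltr01) := fc (delta_mx 0 j) p Up.
  apply: filterS => x hx.
  rewrite -[X in `|X|](subrK ('D_(delta_mx 0 j) f p)) addrC.
  by rewrite (le_trans (ler_normD _ _))// lerD2l distrC ltW.
move=> /nbhs_ballP[r /= r0 Hr].
pose K := \sum_j (`|'D_(delta_mx 0 j) f p| + 1) + 1.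
have K0' : 0 <= \sum_(j < d) (`|'D_(delta_mx 0 j) f p| + 1).
  by apply: sumr_ge0 => j _; rewrite addr_ge0.
have K0 : 0 < K by rewrite ltr_wpDl.
exists r, K; split=> // x y xr yr.
apply: norm_mx_le => [|i j]; first by rewrite mulr_ge0// ltW.
rewrite ord1 {i}.
pose v := y - x.
have inB (t : R) : 0 <= t <= 1 -> ball p r (x + t *: v).
  move=> /andP[t0 t1]; rewrite -ball_normE /ball_/= distrC.
  rewrite (_ : x + t *: v - p = (1 - t) *: (x - p) + t *: (y - p)); last first.
    by apply/rowP => l; rewrite !mxE; ring.
  rewrite (le_lt_trans (ler_normD _ _))// !normrZ !ger0_norm ?subr_ge0//.
  set X := `|x - p| in xr *; set Y := `|y - p| in yr *.
  have mr : Num.max X Y < r by rewrite gt_max xr.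
  have hX : (1 - t) * X <= (1 - t) * Num.max X Y.
    by rewrite ler_wpM2l ?subr_ge0// le_max lexx.
  have hY : t * Y <= t * Num.max X Y by rewrite ler_wpM2l// le_max lexx orbT.
  by move: hX hY mr; set Z := Num.max X Y; lra.
pose F t := f (x + t *: v) 0 j.
have dF (t : R) : 0 <= t <= 1 -> is_derive t 1 F (('D_v f (x + t *: v)) 0 j).
  move=> /inB/Hr[Ux _]; apply: (@is_derive_line _ _ _ (fun y => f y 0 j)).
  by apply: is_derive_coord; apply: diff_derivable; exact: fd.
have [t t01 Ft] : exists2 t, t \in `]0, 1[%R &
    F 1 - F 0 = (('D_v f (x + t *: v)) 0 j) * (1 - 0).
  apply: (@MVT _ F (fun t => ('D_v f (x + t *: v)) 0 j)) => //.
    by move=> t; rewrite in_itv/= => /andP[x0 xs]; apply: dF; rewrite !ltW.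
  apply: derivable_within_continuous => t; rewrite in_itv/= => x0s.
  by have [] := dF t x0s.
have t0 : 0 <= t <= 1 by move: t01; rewrite in_itv/= => /andP[? ?]; rewrite !ltW.
have xv : x + v = y by rewrite /v addrC subrK.
move: Ft; rewrite /F scale1r scale0r addr0 subr0 mulr1 xv.
have [Ut Dt] := Hr _ (inB t t0).
move=> E; rewrite !mxE distrC E (le_trans (norm_coord _ _ _))//.
rewrite derive_coord_expand; last exact: fd.
rewrite (le_trans (ler_norm_sum _ _ _))// mulrDl mul1r mulr_suml.
rewrite (le_trans (_ : _ <= \sum_(l < d) (`|'D_(delta_mx 0 l) f p| + 1) * `|x - y|))//.
  apply: ler_sum => l _; rewrite normrZ mulrC ler_pM//.
  by rewrite -normrN opprB; exact: norm_coord.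
by rewrite lerDl.
Unshelve. all: by end_near. Qed.

Section Chart.
Variables (R : realType) (d k : nat) (M : set 'rV[R]_d).
Hypothesis kd : (k <= d)%N.
Variables (U V : set 'rV[R]_d) (f g : 'rV[R]_d -> 'rV[R]_d).
Hypothesis (Uop : open U) (Vop : open V).
Hypothesis (fsm : smooth_on U f) (gsm : smooth_on V g).
Hypothesis fK : forall x, U x -> V (f x) /\ g (f x) = x.
Hypothesis gK : forall y, V y -> U (g y) /\ f (g y) = y.
Hypothesis UM : forall x, U x ->
  (M x <-> forall j : 'I_d, (k <= j)%N -> f x 0 j = 0).

Definition coord_vec (i : 'I_k) : 'rV[R]_d := delta_mx 0 (widen_ord kd i).

Definition slice : set 'rV[R]_d :=
  [set y | V y /\ forall j : 'I_d, (k <= j)%N -> y 0 j = 0].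

Definition coord_frame (y : 'rV[R]_d) : 'M[R]_(k, d) :=
  \matrix_(i, j) ('D_(coord_vec i) g y) 0 j.

Lemma slice_M y : slice y -> M (g y).
Proof. by move=> [Vy y0]; have [Ug e] := gK Vy; apply/(UM Ug); rewrite e. Qed.

Lemma chart_derivable y v : V y -> derivable g y v.
Proof. by move=> Vy; apply: diff_derivable; exact: (gsm 1).1. Qed.

Lemma row_coord_frame y i : row i (coord_frame y) = 'D_(coord_vec i) g y.
Proof. by apply/rowP => j; rewrite !mxE. Qed.

(** A curve in [M] is the image under [g] of a curve in the coordinate
    subspace, so its velocity is a combination of the coordinate velocities. *)
Lemma tangent_coord_frame y v : slice y -> tangent M (g y) v ->
  exists a : 'rV[R]_k, v = a *m coord_frame y.
Proof.
move=> [Vy y0] [e [c [e0 csm cM c0 cv]]].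
have [Ugy fgy] := gK Vy.
have z0 : `|(0 : R)| < e by rewrite normr0.
have cd : differentiable c 0 by exact: (csm 1).1.
have fd : differentiable f (c 0) by apply: (fsm 1).1; rewrite c0.
have gd : differentiable g (f (c 0)) by apply: (gsm 1).1; rewrite c0 fgy.
pose h := f \o c.
have hd : differentiable h 0 by exact: differentiable_comp.
have Unear : \forall t \near (0 : R), U (c t).
  have := differentiable_continuous cd; apply.
  by rewrite c0; exact: open_nbhs_nbhs.
have h0 : h 0 = y by rewrite /h/= c0.
have hj (j : 'I_d) : (k <= j)%N -> ('D_1 h 0) 0 j = 0.
  move=> kj; have [_ <-] := is_derive_coord j (@diff_derivable _ _ _ h 0 1 hd).
  have E : \forall t \near (0 : R), h t 0 j = (cst 0 : R -> R) t.
    near=> t; rewrite /cst.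
    have Ut : U (c t) by near: t.
    have Mt : M (c t).
      apply: cM; near: t.
      have /nbhs_ballP := (@nbhsx_ballx _ _ (0 : R) e e0).
      by move=> _; apply: filterS (nbhsx_ballx (0 : R) e e0) => t; rewrite -ball_normE/= sub0r normrN.
    exact: ((UM Ut).1 Mt).
  by rewrite (near_eq_derive _ E) derive_cst.
have E : \forall t \near (0 : R), c t = (g \o h) t.
  by near=> t; have /fK[_] : U (c t) by near: t.
exists (\row_i ('D_1 h 0) 0 (widen_ord kd i)).
rewrite -cv (near_eq_derive _ E) deriveE; last exact: differentiable_comp.
have gdh : differentiable g (h 0) := gd.
have -> : 'd (g \o h) 0 1 = 'D_('D_1 h 0) g (h 0).
  by rewrite diff_comp//= (deriveE _ gdh) (deriveE _ hd).
rewrite (derive_coord_expand _ gdh) h0.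
rewrite (bigID (fun j : 'I_d => (j < k)%N))/= [X in _ + X]big1 ?addr0; last first.
  by move=> j; rewrite -leqNgt => /hj ->; rewrite scale0r.
rewrite (big_ord_narrow kd)/=; apply/rowP => l.
rewrite summxE mxE; apply: eq_bigr => i _.
by rewrite !mxE.
Unshelve. all: by end_near. Qed.

Lemma free_tangent_coord_frame y (B : 'M[R]_(k, d)) :
  slice y -> row_free B -> (forall i, tangent M (g y) (row i B)) ->
  exists2 A : 'M[R]_k, A \in unitmx & B = A *m coord_frame y.
Proof.
move=> Sy Bfree Btan.
have /choice[a aE] : forall i, exists a : 'rV[R]_k, row i B = a *m coord_frame y.
  by move=> i; exact: tangent_coord_frame Sy (Btan i).
have BE : B = (\matrix_i a i) *m coord_frame y.
  by apply/row_matrixP => i; rewrite row_mul rowK aE.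
exists (\matrix_i a i) => //; rewrite -row_free_unit -row_leq_rank.
by move: Bfree; rewrite -row_leq_rank BE => /leq_trans; apply; exact: mxrankM_maxl.
Qed.

Lemma coord_frame_line y i : slice y ->
  \forall t \near (0 : R), slice (y + t *: coord_vec i).
Proof.
move=> [Vy y0]; have := near_line (coord_vec i) Vop Vy.
apply: filterS => t Vt; split=> // j kj.
rewrite !mxE y0// add0r eqxx/=.
rewrite (_ : (j == _) = false) ?mulr0//.
apply/negP => /eqP e; move: kj; rewrite e /=.
by rewrite leqNgt ltn_ord.
Qed.

Lemma coord_frame_sym y (i a : 'I_k) : V y ->
  'D_(coord_vec i) ('D_(coord_vec a) g) y =
  'D_(coord_vec a) ('D_(coord_vec i) g) y.
Proof.
move=> Vy; apply/rowP => b.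
have der x u : V x -> derivable g x u by exact: chart_derivable.
have der2 x u v : V x -> derivable ('D_u g) x v.
  by move=> Vx; apply: diff_derivable; exact: ((gsm 2).2 u).1.
have cont u v : {for y, continuous (fun x => ('D_v ('D_u g) x) 0 b)}.
  have cDD : {for y, continuous ('D_v ('D_u g))} by exact: (((gsm 2).2 u).2 v).
  apply: (@continuous_comp _ _ _ ('D_v ('D_u g)) (fun m : 'rV_d => m 0 b)) => //.
  exact: coord_continuous.
apply: (@schwarz R _ (fun x => g x 0 b) (fun x => ('D_(coord_vec a) g x) 0 b)
  (fun x => ('D_(coord_vec i) g x) 0 b)
  (fun x => ('D_(coord_vec i) ('D_(coord_vec a) g) x) 0 b)
  (fun x => ('D_(coord_vec a) ('D_(coord_vec i) g) x) 0 b) V y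
  (coord_vec a) (coord_vec i)) => //.
- by move=> x Vx; apply: is_derive_coord; exact: der.
- by move=> x Vx; apply: is_derive_coord; exact: der.
- by move=> x Vx; apply: is_derive_coord; exact: der2.
- by move=> x Vx; apply: is_derive_coord; exact: der2.
Qed.
End Chart.

Lemma det_scale_row (R : realType) (m d : nat) (i : 'I_m) (c : R)
    (A : 'M[R]_m) (B : 'M[R]_(m, d)) :
  exists2 A' : 'M[R]_m, \det A' = c * \det A &
    set_row i (c *: row i (A *m B)) (A *m B) = A' *m B.
Proof.
exists (diag_mx (\row_j (if j == i then c else 1)) *m A).
  by rewrite det_mulmx det_scale_diag.
by rewrite scale_row_diag mulmxA.
Qed.

(** The hypothesis is the derivative, along the [i]-th coordinate, of the form
    evaluated on the frame [P] whose [i]-th vector is replaced by the position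
    [q]; the [i]-th vector of [P] is the derivative of [q], and [H i a] is the
    derivative of the [a]-th vector of [P].  Summing over [i], the term [w P]
    occurs [k] times, and the terms in [H i a] and [H a i] cancel. *)
Lemma form_divergence (R : realType) (d k : nat) (w : 'M[R]_(k, d) -> R)
    (P : 'M[R]_(k, d)) (q : 'rV[R]_d) (H : 'I_k -> 'I_k -> 'rV[R]_d) :
  multilinear_alternating w -> (0 < k)%N ->
  (forall i a, H i a = H a i) ->
  (forall i, \sum_a w (set_row a (if a == i then row i P else H i a)
      (set_row i q P)) = 0) ->
  w P = 0.
Proof.
move=> hw k0 Hsym sum0.
pose T i a := w (set_row a (H i a) (set_row i q P)).
have key i : w P + \sum_(a | a != i) T i a = 0.
  have := sum0 i; rewrite (bigD1 i)//= eqxx set_row_set_row set_row_id => s0.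
  rewrite -[RHS]s0.
  by congr (_ + _); apply: eq_bigr => a /negbTE ->.
have Tanti i a : a != i -> T a i = - T i a.
  by move=> ai; rewrite /T Hsym form_swap// 1?eq_sym// set_rowC// eq_sym.
have X0 : \sum_i \sum_(a | a != i) T i a = 0.
  set X := (X in X = 0).
  have XN : X = - X.
    rewrite {1}/X (exchange_big_dep predT)//= -sumrN; apply: eq_bigr => a _.
    rewrite -sumrN; apply: eq_big => [i|i ai]; first by rewrite eq_sym.
    by rewrite [in RHS]Tanti// opprK.
  lra.
have : \sum_(i < k) (w P + \sum_(a | a != i) T i a) = 0 by rewrite big1.
rewrite big_split/= X0 addr0 sumr_const card_ord => /eqP.
by rewrite mulrn_eq0 eqn0Ngt k0/= => /eqP.
Qed.

(** Let [beta] be the contraction of the constant form [w] with the position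
    vector, so that [d beta = k w].  If [beta] vanishes along the submanifold
    then so does [d beta], hence [w].  In a chart this is [form_divergence], the
    matrix [H] of second derivatives of the parametrisation being symmetric. *)
Lemma no_radially_null_form (R : realType) (d k : nat)
    (L : oriented_set R d k) (p : 'rV[R]_d) (w : 'M[R]_(k, d) -> R) :
  (0 < k)%N -> embedded_submanifold k (carrier L) -> is_orientation L ->
  carrier L p -> multilinear_alternating w ->
  (forall q B, carrier L q -> pos_frame L q B ->
    w B <> 0 /\ forall i, w (set_row i q B) = 0) -> False.
Proof.
move=> k0 [kd ML] [ori1 ori2 ori3] Lp hw wL.
have [U [V [f [g [[Uop Vop] Up [fsm gsm] [fK gK] UM]]]]] := ML p Lp.
pose e := coord_vec R kd; pose P := coord_frame kd g.
pose Sl := @slice R d k V.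
have fp : Sl (f p).
  have [Vfp _] := fK p Up; split=> //; exact: (UM _ Up).1.
have wP y : Sl y -> w (P y) <> 0 /\ forall i, w (set_row i (g y) (P y)) = 0.
  move=> Sy; have Lq := slice_M gK UM Sy.
  have [W [F [_ Wq _ Fpos]]] := ori3 _ Lq.
  have Bpos := Fpos _ Lq Wq; set B := F _ in Bpos.
  have [Bfree Btan] := ori1 _ _ Lq Bpos.
  have [A Au BE] :=
    free_tangent_coord_frame kd Uop fsm gsm fK gK UM Sy Bfree Btan.
  rewrite -/(P y) in BE.
  have PE : P y = invmx A *m B by rewrite BE mulKmx.
  have detA : \det (invmx A) != 0.
    by rewrite -unitfE -unitmxE unitmx_inv.
  have [detA0|detA0] := ltP 0 (\det (invmx A)).
    have Ppos : pos_frame L (g y) (P y) by rewrite PE; apply/ori2.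
    exact: wL.
  (* Otherwise changing the sign of one row of [P y] gives a positive frame. *)
  pose i0 : 'I_k := Ordinal k0.
  have [A' detA' PA'] := det_scale_row i0 (-1) (invmx A) B.
  rewrite -PE in PA'; set P' := set_row _ _ _ in PA'.
  have P'pos : pos_frame L (g y) P'.
    rewrite PA'; apply/ori2 => //.
    by rewrite detA' mulN1r oppr_gt0 lt_neqAle detA.
  have [wP' wP'i] := wL _ _ Lq P'pos.
  have wP'E : w P' = - w (P y) by rewrite /P' form_set_rowZ// set_row_id mulN1r.
  split=> [wP0|i]; first by apply: wP'; rewrite wP'E wP0 oppr0.
  have [->|ii0] := eqVneq i i0; first by rewrite -(wP'i i0) /P' set_row_set_row.
  have := wP'i i; rewrite /P' set_rowC// form_set_rowZ// -(row_set_row_neq (g y) (P y) (i := i)) 1?eq_sym//.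
  by rewrite set_row_id mulN1r => /eqP; rewrite oppr_eq0 => /eqP.
set y := f p in fp; have Vy : V y := fp.1.
pose H i a := 'D_(e i) ('D_(e a) g) y.
have Hsym i a : H i a = H a i by exact: (coord_frame_sym kd Vop gsm).
have wP0 : w (P y) = 0.
  apply: (form_divergence (q := g y) (H := H) hw k0 Hsym) => i.
  pose E t := set_row i (g (y + t *: e i)) (P (y + t *: e i)).
  pose E' : 'M[R]_(k, d) :=
    \matrix_(a, b) if a == i then ('D_(e i) g y) 0 b else H i a 0 b.
  have y0 : y = y + 0 *: e i by rewrite scale0r addr0.
  have dE a b : is_derive (0 : R) 1 (fun t => E t a b) (E' a b).
    rewrite mxE; case: (eqVneq a i) => [->|ai].
      under eq_fun do rewrite mxE eqxx.
      apply: (@is_derive_line0 _ _ _ (fun y => g y 0 b)).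
      by apply: is_derive_coord; exact: chart_derivable gsm _ _ Vy.
    under eq_fun do rewrite mxE (negbTE ai) mxE.
    apply: (@is_derive_line0 _ _ _ (fun y => ('D_(e a) g y) 0 b)).
    apply: is_derive_coord; apply: diff_derivable.
    exact: ((gsm 2).2 (e a)).1.
  have [_ dw] := is_derive_form hw dE.
  have wE0 : \forall t \near (0 : R), w (E t) = (cst 0 : R -> R) t.
    have := coord_frame_line kd Vop i fp; apply: filterS => t St.
    exact: (wP _ St).2.
  have EE0 : E 0 = set_row i (g y) (P y) by rewrite /E -y0.
  rewrite (near_eq_derive _ wE0) derive_cst in dw.
  rewrite [RHS]dw EE0.
  apply: eq_bigr => a _; congr (w (set_row _ _ _)).
  apply/rowP => b; rewrite [RHS]mxE [RHS]mxE.
  by case: (eqVneq a i) => _; [rewrite row_coord_frame|reflexivity].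
exact: (wP _ fp).1.
Qed.

(** * Parametrisations of an oriented submanifold of the sphere *)

Lemma tangent_orth (R : realType) (d : nat) (M : set 'rV[R]_d) p v :
  M `<=` @unit_sphere R d -> tangent M p v -> dot p v = 0.
Proof.
move=> MS [e [c [e0 csm cM <- <-]]].
have c0 : `|(0 : R)| < e by rewrite normr0.
have cd : derivable c 0 1 by apply: diff_derivable; exact: (csm 1).1.
have dj j := is_derive_coord j cd.
have dd : is_derive (0 : R) 1 (\sum_j (fun t => c t 0 j) * (fun t => c t 0 j))
   (\sum_j (c 0 0 j *: ('D_1 c 0) 0 j + c 0 0 j *: ('D_1 c 0) 0 j)).
  by apply: is_derive_sum => j; apply: is_deriveM.
have E : \forall t \near (0 : R),
    (\sum_j (fun t => c t 0 j) * (fun t => c t 0 j)) t = (cst 1 : R -> R) t.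
  apply: filterS (nbhsx_ballx (0 : R) e e0) => t.
  rewrite -ball_normE/= sub0r normrN => /cM/MS.
  rewrite /unit_sphere/= dotE => <-; rewrite fct_sumE.
  by apply: eq_bigr.
have [_] := dd; rewrite (near_eq_derive _ E) derive_cst => /esym.
rewrite big_split/= => h; rewrite dotE.
have -> : \sum_j c 0 0 j * ('D_1 c 0) 0 j = \sum_i c 0 0 i *: ('D_1 c 0) 0 i by [].
lra.
Qed.

Lemma position_norm_le1 (R : realType) (d : nat) (u : 'rV[R]_d) :
  unit_sphere u -> `|u| <= 1.
Proof.
rewrite /unit_sphere/= => u1; apply: norm_mx_le => // i j; rewrite ord1.
rewrite -(@expr_le1 _ 2)//= -normrX ger0_norm ?sqr_ge0//.
rewrite -u1 dotE (bigD1 j)//= -expr2 lerDl.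
by apply: sumr_ge0 => l _; rewrite -expr2 sqr_ge0.
Qed.

(** A local section of positive frames is corrected by the constant change of
    basis that takes its value at [p] to [B]. *)
Lemma frame_section (R : realType) (d k : nat) (L : oriented_set R d k) p B :
  embedded_submanifold k (carrier L) -> is_orientation L ->
  carrier L p -> pos_frame L p B ->
  exists (U : set 'rV[R]_d) (F : 'rV[R]_d -> 'M[R]_(k, d)),
    [/\ open U, U p, {within carrier L `&` U, continuous F}, F p = B &
        forall q, carrier L q -> U q -> pos_frame L q (F q)].
Proof.
move=> [kd ML] [ori1 ori2 ori3] Lp Bpos.
have [U [V [f [g [[Uop Vop] Up [fsm gsm] [fK gK] UM]]]]] := ML p Lp.
have [Vfp gfp] := fK p Up.
have Sl : slice k V (f p) by split=> //; exact: (UM _ Up).1.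
have frameE C : pos_frame L p C ->
    exists2 A, A \in unitmx & C = A *m coord_frame kd g (f p).
  move=> /(ori1 _ _ Lp)[Cfree Ctan]; rewrite -gfp in Ctan.
  exact: (free_tangent_coord_frame kd Uop fsm gsm fK gK UM Sl Cfree Ctan).
have [W [F [Wop Wp Fc Fpos]]] := ori3 p Lp.
have [A1 A1u BE] := frameE _ Bpos.
have [A2 A2u FE] := frameE _ (Fpos _ Lp Wp).
pose A := A1 *m invmx A2.
have AF : A *m F p = B by rewrite FE BE /A !mulmxA mulmxKV.
have detA : 0 < \det A by apply/(ori2 p (F p)) => //; [exact: Fpos|rewrite AF].
exists W, (fun q => A *m F q); split=> // [|q Lq Wq]; last first.
  by apply/ori2 => //; exact: Fpos.
apply/subspace_continuousP => q Aq.
have := (subspace_continuousP _ _).1 Fc q Aq => Fq.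
apply/cvgrPdist_le => /= e e0.
have D0 : 0 < `|A| *+ k + 1 by rewrite ltr_wpDl// mulrn_wge0.
move/cvgrPdist_le : Fq => /(_ (e / (`|A| *+ k + 1))) /=.
rewrite divr_gt0// => /(_ isT); apply: filterS => x hx.
rewrite -mulmxBr; apply: norm_mx_le => [|i j]; first exact: ltW.
rewrite mxE (le_trans (ler_norm_sum _ _ _))//.
rewrite (le_trans (_ : _ <= \sum_(l < k) `|A| * (e / (`|A| *+ k + 1))))//.
  apply: ler_sum => l _; rewrite normrM ler_pM//; first exact: norm_coord.
  by rewrite (le_trans (norm_coord _ _ _)).
rewrite sumr_const card_ord -mulrnAl mulrCA ger_pMr//.
by rewrite ler_pdivrMr// mul1r lerDl.
Qed.

(** The inverse of a slice chart, restricted to the coordinate subspace.  Its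
    inverse is Lipschitz since the chart is continuously differentiable. *)
Lemma local_param (R : realType) (d k : nat) (L : oriented_set R d k) p B :
  embedded_submanifold k (carrier L) -> is_orientation L ->
  carrier L p -> pos_frame L p B ->
  exists (c : 'rV[R]_k -> 'rV[R]_d) (F : 'rV[R]_k -> 'M[R]_(k, d)) (r K : R),
    [/\ 0 < r /\ 0 < K, c 0 = p /\ F 0 = B,
      forall z, `|z| < r -> carrier L (c z) /\ pos_frame L (c z) (F z),
      forall z z', `|z| < r -> `|z'| < r -> `|z - z'| <= K * `|c z - c z'| &
      {for 0, continuous c} /\ {for 0, continuous F}].
Proof.
move=> Lemb Lori Lp Bpos.
have [W [F [Wop Wp Fc FB Fpos]]] := frame_section Lemb Lori Lp Bpos.
have [kd ML] := Lemb.
have [U [V [f [g [[Uop Vop] Up [fsm gsm] [fK gK] UM]]]]] := ML p Lp.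
have [Vfp gfp] := fK p Up.
have fp0 : forall j : 'I_d, (k <= j)%N -> f p 0 j = 0 by exact: (UM _ Up).1.
have [r1 [K [r10 K0 Lip]]] := C1_lipschitz Uop Up (fsm 1).
pose pad (z : 'rV[R]_k) : 'rV[R]_d := \sum_i z 0 i *: coord_vec R kd i.
have padE z i : pad z 0 (widen_ord kd i) = z 0 i.
  rewrite /pad summxE (bigD1 i)//= !mxE !eqxx mulr1 big1 ?addr0// => j ji.
  by rewrite !mxE eqxx/= -val_eqE/= val_eqE eq_sym (negbTE ji) mulr0.
have pad_out z (j : 'I_d) : (k <= j)%N -> pad z 0 j = 0.
  move=> kj; rewrite /pad summxE big1// => i _; rewrite !mxE eqxx/=.
  by rewrite -val_eqE/= gtn_eqF ?mulr0// (leq_trans (ltn_ord i)).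
have pad_le z : `|pad z| <= `|z|.
  apply: norm_mx_le => // i j; rewrite ord1.
  have [kj|jk] := leqP k j; first by rewrite pad_out// normr0.
  have -> : j = widen_ord kd (Ordinal jk) by apply/val_inj.
  by rewrite padE norm_coord.
have pad0 : pad 0 = 0.
  by apply/eqP; rewrite -normr_le0 (le_trans (pad_le _))// normr0.
pose c z := g (f p + pad z).
have c0 : c 0 = p by rewrite /c pad0 addr0.
have padc : {for 0, continuous (fun z => f p + pad z)}.
  rewrite /prop_for /continuous_at pad0 addr0.
  move=> A /nbhs_ballP[e /= e0 HA]; apply/nbhs_ballP; exists e => //= z.
  rewrite -ball_normE/= sub0r normrN => ze; apply: HA.
  by rewrite -ball_normE/= opprD addrA subrr sub0r normrN (le_lt_trans (pad_le _)).
have cc : {for 0, continuous c}.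
  apply: continuous_comp => //; rewrite pad0 addr0.
  by apply: differentiable_continuous; exact: (gsm 1).1.
have Lc z : V (f p + pad z) -> carrier L (c z).
  move=> Vz; have [Uc fc] := gK _ Vz; apply/(UM _ Uc); rewrite fc => j kj.
  by rewrite mxE fp0// pad_out// addr0.
have : \forall z \near (0 : 'rV[R]_k), [/\ V (f p + pad z), W (c z) & `|c z - p| < r1].
  near=> z; split; near: z.
  - by apply: padc; rewrite pad0 addr0; exact: open_nbhs_nbhs.
  - by apply: cc; rewrite c0; exact: open_nbhs_nbhs.
  - move/cvgrPdist_lt : cc => /(_ r1 r10); apply: filterS => z.
    by rewrite c0 distrC.
move=> /nbhs_ballP[r /= r0 Hr].
have {}Hr z : `|z| < r -> [/\ V (f p + pad z), W (c z) & `|c z - p| < r1].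
  by move=> zr; apply: Hr; rewrite -ball_normE/= sub0r normrN.
exists c, (F \o c), r, K; split; first by [].
- by split; [exact: c0|rewrite /= c0].
- move=> z /Hr[Vz Wz _]; split; first exact: Lc.
  by apply: Fpos => //; exact: Lc.
- move=> z z' /Hr[Vz _ cz] /Hr[Vz' _ cz'].
  apply: le_trans (Lip _ _ cz cz').
  have [_ fz] := gK _ Vz; have [_ fz'] := gK _ Vz'.
  rewrite /c fz fz'; apply: norm_mx_le => // i j; rewrite ord1.
  rewrite (le_trans _ (norm_coord _ 0 (widen_ord kd j)))//.
  by rewrite !mxE !padE opprD addrACA subrr add0r.
- split=> //; rewrite /prop_for /continuous_at /= c0 => A HA.
  have Fp : \forall q \near p, (carrier L `&` W) q -> A (F q).
    exact: ((subspace_continuousP _ _).1 Fc p (conj Lp Wp) A HA).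
  rewrite -c0 in Fp; have cA := cc _ Fp.
  have /nbhs_ballP[e /= e0 He] := cA.
  apply/nbhs_ballP; exists (Num.min e r); first by rewrite /= lt_min e0 r0.
  move=> z; rewrite -ball_normE/= sub0r normrN lt_min => /andP[ze zr].
  have [Vz Wz _] := Hr _ zr.
  have /He/= h : ball 0 e z by rewrite -ball_normE/= sub0r normrN.
  by apply: h; split; [exact: Lc|].
Unshelve. all: by end_near. Qed.

(** * Frames of the cone over a product *)

Section Blocks.
Variables (R : realType) (n : nat) (k d : 'I_n -> nat).
Implicit Types (B : forall i, 'M[R]_(k i, d i)).

(** The inclusion of a factor, written as in [block_diag]. *)
Definition emb i (v : 'rV[R]_(d i)) : 'rV[R]_(\sum_i d i) :=
  \mxrow_j (if i == j then conform_mx 0 v else 0).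

Lemma submxrow_emb i (v : 'rV[R]_(d i)) : submxrow (emb v) i = v.
Proof. by rewrite mxrowK eqxx conform_mx_id. Qed.

Lemma submxrow_emb_neq i j (v : 'rV[R]_(d i)) : i != j -> submxrow (emb v) j = 0.
Proof. by move=> ij; rewrite mxrowK (negbTE ij). Qed.

Lemma submxrowZ m a (u : 'M[R]_(m, \sum_i d i)) i :
  submxrow (a *: u) i = a *: submxrow u i.
Proof. by apply/matrixP => b j; rewrite !mxE. Qed.

Lemma embP a b i (u v : 'rV[R]_(d i)) :
  emb (a *: u + b *: v) = a *: emb u + b *: emb v.
Proof.
apply/mxrowP => j; rewrite submxrowD !submxrowZ.
have [<-|ij] := eqVneq i j; first by rewrite !submxrow_emb.
by rewrite !submxrow_emb_neq// !scaler0 addr0.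
Qed.

Lemma dot_submxrow (u v : 'rV[R]_(\sum_i d i)) :
  dot u v = \sum_i dot (submxrow u i) (submxrow v i).
Proof.
rewrite /dot -[in LHS](submxrowK u) -[in LHS](submxrowK v) tr_mxrow.
by rewrite mul_mxrow_mxcol summxE.
Qed.

Lemma dot_emb i (u : 'rV[R]_(d i)) v : dot (emb u) v = dot u (submxrow v i).
Proof.
rewrite dot_submxrow (bigD1 i)//= submxrow_emb big1 ?addr0// => j ji.
by rewrite submxrow_emb_neq 1?eq_sym// /dot mul0mx mxE.
Qed.

Lemma product_point_sum (x : forall i, 'rV[R]_(d i)) :
  product_point k x = \sum_i minimal_weight R k i *: emb (x i).
Proof.
apply/mxrowP => j; rewrite mxrowK submxrow_sum (bigD1 j)//=.
rewrite submxrowZ submxrow_emb big1 => [|i ij]; first by rewrite [RHS]addr0.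
by rewrite submxrowZ submxrow_emb_neq// scaler0.
Qed.

Lemma row_block_diag B i a :
  row (tagnat.Rank i a) (block_diag B) = emb (row a (B i)).
Proof.
have -> : row (tagnat.Rank i a) (block_diag B) =
    row a (submxcol (block_diag B) i).
  by apply/rowP => j; rewrite !mxE.
rewrite submxcol_matrix row_mxrow; apply/eq_mxrow => j.
case: (eqVneq i j) => [<-|ij]; first by rewrite !conform_mx_id.
by apply/rowP => b; rewrite !mxE.
Qed.

Lemma mulmx_block_diag (u : 'rV[R]_(\sum_i k i)) B i :
  submxrow (u *m block_diag B) i = submxrow u i *m B i.
Proof.
rewrite -[in LHS](submxrowK u) mul_mxrow_mxblock mxrowK (bigD1 i)//= eqxx.
rewrite conform_mx_id big1 ?addr0// => j ji.
by rewrite (negbTE ji) mulmx0.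
Qed.

Definition cone_frame (u : 'rV[R]_(\sum_i d i)) B :
  'M[R]_(1 + \sum_i k i, \sum_i d i) := col_mx u (block_diag B).

Definition radial_row : 'I_(1 + \sum_i k i) := lshift _ ord0.
Definition factor_row i (a : 'I_(k i)) : 'I_(1 + \sum_i k i) :=
  rshift 1 (tagnat.Rank i a).

Lemma cone_row_ind (P : 'I_(1 + \sum_i k i) -> Prop) :
  P radial_row -> (forall i (a : 'I_(k i)), P (factor_row a)) -> forall r, P r.
Proof.
move=> P0 P1 r; rewrite -(splitK r); case: (fintype.split r) => /= s.
  by rewrite (ord1 s); exact: P0.
by rewrite -(tagnat.sig2K s); exact: P1.
Qed.

Lemma row_cone_frame0 u B : row radial_row (cone_frame u B) = u.
Proof. by rewrite rowKu; apply/rowP => j; rewrite mxE. Qed.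

Lemma row_cone_frame u B i (a : 'I_(k i)) :
  row (factor_row a) (cone_frame u B) = emb (row a (B i)).
Proof. by rewrite rowKd row_block_diag. Qed.

Lemma set_row_cone_frame0 u v B :
  set_row radial_row v (cone_frame u B) = cone_frame v B.
Proof.
apply/row_matrixP => r; elim/cone_row_ind: r => [|i a].
  by rewrite row_set_row row_cone_frame0.
by rewrite row_set_row_neq ?row_cone_frame// eq_sym eq_lrshift.
Qed.

Lemma factor_row_inj i (a b : 'I_(k i)) : (factor_row a == factor_row b) = (a == b).
Proof.
by rewrite (inj_eq (@rshift_inj _ _)) -val_eqE tagnat.eq_Rank eqxx val_eqE.
Qed.

Lemma set_row_cone_frame u B i (V : 'M[R]_(k i, d i)) (a : 'I_(k i)) v :
  set_row (factor_row a) (emb v) (cone_frame u (dfwith B V)) =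
  cone_frame u (dfwith B (set_row a v V)).
Proof.
apply/row_matrixP => r; elim/cone_row_ind: r => [|j b].
  by rewrite row_set_row_neq ?row_cone_frame0// eq_lrshift.
have [ij|ij] := eqVneq i j; last first.
  rewrite row_set_row_neq ?row_cone_frame ?dfwith_out//.
  rewrite (inj_eq (@rshift_inj _ _)) -val_eqE tagnat.eq_Rank.
  by rewrite eq_sym (negbTE ij).
case: j / ij in b *.
have [->|ba] := eqVneq b a.
  by rewrite row_set_row row_cone_frame dfwith_in row_set_row.
rewrite row_set_row_neq ?factor_row_inj// !row_cone_frame !dfwith_in.
by rewrite row_set_row_neq.
Qed.
End Blocks.

Lemma multilinear_alternatingI (R : realType) (m d : nat)
    (w : 'M[R]_(m, d) -> R) :
  (forall i b c u v A, w (set_row i (b *: u + c *: v) A) =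
     b * w (set_row i u A) + c * w (set_row i v A)) ->
  (forall i j u A, i != j -> w (set_row i u (set_row j u A)) = 0) ->
  multilinear_alternating w.
Proof.
move=> lin alt; split=> [A B C i b c rA rB rC|A i j ij e].
  have E X : row' i X = row' i A -> X = set_row i (row i X) A.
    move=> e; apply/row_matrixP => r; have [->|ri] := eqVneq r i.
      by rewrite row_set_row.
    rewrite row_set_row_neq//; rewrite eq_sym in ri.
    have [r' -> _] := unlift_some ri.
    apply/rowP => l; have /matrixP/(_ r' l) := e.
    by rewrite !mxE.
  by rewrite (E A erefl) rA lin -(E B rB) -(E C rC).
by rewrite -(set_row_id i A) -{2}(set_row_id j A) e alt.
Qed.

(** [t ^ 2 - t' ^ 2] is the scalar product of [t u - t' u'] and [t u + t' u']. *)
Lemma dist_scale_unit (R : realType) (d : nat) (u u' : 'rV[R]_d) (t t' : R) :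
  unit_sphere u -> unit_sphere u' -> 0 < t -> 0 < t' ->
  `|t - t'| <= d%:R * `|t *: u - t' *: u'|.
Proof.
move=> u1 u'1 t0 t'0; set a := t *: u - t' *: u'.
have a_le j : `|a 0 j| <= `|a| by exact: norm_coord.
have b_le j : `|(t *: u + t' *: u') 0 j| <= t + t'.
  rewrite !mxE (le_trans (ler_normD _ _))// !normrM !(gtr0_norm t0) (gtr0_norm t'0).
  apply: lerD; rewrite -[leRHS]mulr1 ler_pM2l// (le_trans (norm_coord _ _ _))//.
    exact: position_norm_le1.
  exact: position_norm_le1.
have E : dot a (t *: u + t' *: u') = (t - t') * (t + t').
  rewrite /a -scaleNr !(dotDl, dotDr, dotZl, dotZr) (dotC u').
  by rewrite u1 u'1; ring.
have tt' : 0 < t + t' by rewrite addr_gt0.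
rewrite -(ler_pM2r tt') -[X in _ * X <= _](gtr0_norm tt') -normrM -E dotE.
rewrite (le_trans (ler_norm_sum _ _ _))//.
rewrite (le_trans (_ : _ <= \sum_(j < d) `|a| * (t + t')))//.
  by apply: ler_sum => j _; rewrite normrM ler_pM.
by rewrite sumr_const card_ord -mulrA mulr_natl.
Qed.

Section Weights.
Variables (R : realType) (n : nat) (k : 'I_n -> nat).
Hypothesis k_gt0 : forall i, (0 < k i)%N.
Local Notation lam := (minimal_weight R k).

Lemma sum_dims_gt0 (i : 'I_n) : (0 < \sum_j k j)%N.
Proof. by rewrite (bigD1 i)//= ltn_addr. Qed.

Lemma minimal_weight_gt0 i : 0 < lam i.
Proof. by rewrite sqrtr_gt0 divr_gt0// ltr0n// (sum_dims_gt0 i). Qed.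

Lemma minimal_weight_sqr i : lam i ^+ 2 = (k i)%:R / (\sum_j k j)%N%:R.
Proof. by rewrite sqr_sqrtr// divr_ge0. Qed.

Lemma sum_minimal_weight_sqr (i : 'I_n) : \sum_j lam j ^+ 2 = 1.
Proof.
under eq_bigr do rewrite minimal_weight_sqr.
rewrite -mulr_suml -natr_sum divff// pnatr_eq0 -lt0n; exact: sum_dims_gt0 i.
Qed.
End Weights.

Section ConeFrame.
Variables (R : realType) (n : nat) (k d : 'I_n -> nat).
Hypothesis k_gt0 : forall i, (0 < k i)%N.
Variables (x : forall i, 'rV[R]_(d i)) (B : forall i, 'M[R]_(k i, d i)).
Hypothesis x1 : forall i, unit_sphere (x i).
Hypothesis xB : forall i a, dot (x i) (row a (B i)) = 0.
Local Notation X := (product_point k x).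
Local Notation lam := (minimal_weight R k).

Lemma submxrow_product_point i : submxrow X i = lam i *: x i.
Proof. by rewrite mxrowK. Qed.

Lemma product_point_unit (i0 : 'I_n) : dot X X = 1.
Proof.
rewrite dot_submxrow -(sum_minimal_weight_sqr R k_gt0 i0); apply: eq_bigr => i _.
by rewrite submxrow_product_point dotZl dotZr (x1 i) mulr1 expr2.
Qed.

Lemma row_free_cone_frame (i0 : 'I_n) :
  (forall i, row_free (B i)) -> row_free (cone_frame X B).
Proof.
move=> Bfree; rewrite -kermx_eq0; apply/eqP/row_matrixP => r; rewrite row0.
set u := row r _.
have uE : u *m cone_frame X B = 0 by rewrite -row_mul mulmx_ker row0.
rewrite -(hsubmxK u) in uE *; move: (lsubmx u) (rsubmx u) uE => a b.
rewrite mul_row_col => uE.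
have bX : dot (b *m block_diag B) X = 0.
  rewrite dot_submxrow big1// => i _; rewrite mulmx_block_diag.
  rewrite submxrow_product_point dotZr dotC mulmx_sum_row dot_sumr big1 ?mulr0//.
  by move=> l _; rewrite dotZr xB mulr0.
have a0 : a = 0.
  have := congr1 (fun v => dot v X) uE.
  rewrite dotDl bX addr0 [a]mx11_scalar mul_scalar_mx dotZl (product_point_unit i0).
  rewrite mulr1 /dot mul0mx mxE => ->.
  by rewrite -scalemx1 scale0r.
have b0 : b = 0.
  apply/mxrowP => i; rewrite submxrow0.
  apply: (row_free_inj (Bfree i)); rewrite mul0mx -mulmx_block_diag.
  by move: uE; rewrite a0 mul0mx add0r => ->; rewrite submxrow0.
by rewrite a0 b0 row_mx0.
Qed.
End ConeFrame.

Lemma emb_Rank (R : realType) (n : nat) (d : 'I_n -> nat) i (v : 'rV[R]_(d i)) j b :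
  emb v 0 (tagnat.Rank j b) = submxrow (emb v) j 0 b.
Proof. by rewrite [RHS]mxE. Qed.

Section CalibratedFrame.
Variables (R : realType) (n : nat) (k d : 'I_n -> nat).
Variable L : forall i, oriented_set R (d i) (k i).
Hypothesis k_gt0 : forall i, (0 < k i)%N.
Hypothesis L_ori : forall i, is_orientation (L i).
Hypothesis L_sph : forall i, carrier (L i) `<=` @unit_sphere R (d i).
Variable phi : dform R (\sum_i d i) (1 + \sum_i k i).

Lemma pos_frame_orth i q V : carrier (L i) q -> pos_frame (L i) q V ->
  forall a, dot q (row a V) = 0.
Proof.
move=> Lq Vpos a; have [ori1 _ _] := L_ori i.
exact: (tangent_orth (@L_sph i) ((ori1 _ _ Lq Vpos).2 a)).
Qed.

(** The calibration condition concerns positive frames of unit volume; scaling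
    the radial vector of an arbitrary positive frame produces one. *)
Lemma cone_bad_point x B t : (0 < n)%N ->
  (forall i, carrier (L i) (x i)) -> (forall i, pos_frame (L i) (x i) (B i)) ->
  multilinear_alternating (phi (t *: product_point k x)) -> 0 < t ->
  let E := cone_frame (product_point k x) B in
  phi (t *: product_point k x) E ^+ 2 != \det (E *m E^T) ->
  let y := t *: product_point k x in
  carrier (cone (minimal_product L)) y /\
  ~ (forall E, pos_frame (cone (minimal_product L)) y E -> unit_simple E ->
     phi y E = 1).
Proof.
move=> n0 Lx Bpos hphi t0 E ne y.
have i0 : 'I_n := Ordinal n0.
have Efree : row_free E.
  apply: row_free_cone_frame => // [i|i a|i].
  - exact: L_sph.
  - exact: pos_frame_orth.
  - by have [ori1 _ _] := L_ori i; exact: (ori1 _ _ (Lx i) (Bpos i)).1.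
have g0 := gram_gt0 Efree; set g := \det _ in ne g0.
have s0 : 0 < Num.sqrt g by rewrite sqrtr_gt0.
have Xprod : carrier (minimal_product L) (product_point k x) by exists x.
split; first by exists (product_point k x), t; split=> //; exact: ltW.
move=> /(_ (set_row (radial_row k) ((Num.sqrt g)^-1 *: row (radial_row k) E) E)).
have [] : pos_frame (cone (minimal_product L)) y
    (set_row (radial_row k) ((Num.sqrt g)^-1 *: row (radial_row k) E) E) /\
    unit_simple (set_row (radial_row k) ((Num.sqrt g)^-1 *: row (radial_row k) E) E).
  split; last first.
    rewrite /unit_simple gram_scale_row -/g exprVn sqr_sqrtr ?mulVf ?gt_eqF//.
    exact: ltW.
  exists (product_point k x), t, (block_diag B).
  exists (diag_mx (\row_j (if j == radial_row k then (Num.sqrt g)^-1 else 1))).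
  split=> //; last by rewrite scale_row_diag.
    exists x, B, 1%:M; split=> //; first by rewrite det1.
    by rewrite mul1mx.
  by rewrite det_scale_diag invr_gt0.
move=> Epos Eunit /(_ Epos Eunit).
rewrite form_set_rowZ// set_row_id => /(congr1 ( *%R (Num.sqrt g))).
rewrite (mulVKf (lt0r_neq0 s0)) mulr1 => phiE.
by move: ne; rewrite phiE sqr_sqrtr ?eqxx// ltW.
Qed.
End CalibratedFrame.

(** * Measure of the bad points of the cone *)

Section ConeParam.
Variables (R : realType) (n : nat) (k d : 'I_n -> nat).
Hypothesis k_gt0 : forall i, (0 < k i)%N.
Implicit Types w : 'rV[R]_(1 + \sum_i k i).

(** A parameter of the cone consists of the radial coordinate and of one block
    of coordinates for each factor. *)
Definition factor_part w i : 'rV[R]_(k i) :=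
  submxrow (rsubmx w) i.

Lemma factor_partE w i a : factor_part w i 0 a = w 0 (factor_row a).
Proof. by rewrite !mxE. Qed.

Lemma factor_part_le w i : `|factor_part w i| <= `|w|.
Proof.
by apply: norm_mx_le => // r a; rewrite ord1 factor_partE norm_coord.
Qed.

Lemma factor_part0 i : factor_part 0 i = 0.
Proof. by apply/rowP => a; rewrite factor_partE !mxE. Qed.

Lemma continuous_factor_part (T : topologicalType) i (G : 'rV[R]_(k i) -> T) :
  {for 0, continuous G} ->
  {for 0, continuous (fun w => G (factor_part w i))}.
Proof.
move=> cG A; rewrite factor_part0 => /cG/nbhs_ballP[e /= e0 He].
apply/nbhs_ballP; exists e => //= w; rewrite -ball_normE/= sub0r normrN => we.
apply: He; rewrite -ball_normE/= sub0r normrN.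
exact: le_lt_trans (factor_part_le _ _) we.
Qed.

Definition link_param (c : forall i, 'rV[R]_(k i) -> 'rV[R]_(d i)) w :=
  product_point k (fun i => c i (factor_part w i)).

Definition cone_param (c : forall i, 'rV[R]_(k i) -> 'rV[R]_(d i)) w :=
  w 0 (radial_row k) *: link_param c w.

(** Each block of a point of the cone is the radial coordinate times a unit
    vector up to the weight, so its size controls the radial coordinate; away
    from the apex it then controls the unit vector, hence the parameter in that
    factor. *)
Lemma cone_param_expanding (c : forall i, 'rV[R]_(k i) -> 'rV[R]_(d i))
    (r K : 'I_n -> R) (tau : R) :
  (0 < n)%N -> 0 < tau -> (forall i, 0 < K i) ->
  (forall i z, `|z| < r i -> unit_sphere (c i z)) ->
  (forall i z z', `|z| < r i -> `|z'| < r i ->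
     `|z - z'| <= K i * `|c i z - c i z'|) ->
  exists2 C, 0 < C & forall w w',
    (forall i, `|factor_part w i| < r i) -> (forall i, `|factor_part w' i| < r i) ->
    tau <= w 0 (radial_row k) -> tau <= w' 0 (radial_row k) ->
    `|w - w'| <= C * `|cone_param c w - cone_param c w'|.
Proof.
move=> n0 tau0 K0 c1 cK; pose G := cone_param c.
pose lam i := minimal_weight R k i.
have lam0 i : 0 < lam i := minimal_weight_gt0 R k_gt0 i.
pose D i := (d i)%:R / lam i.
pose Z i := K i * ((1 / lam i + D i) / tau).
have D0 i : 0 <= D i by rewrite divr_ge0// ltW.
have Z0 i : 0 <= Z i.
  by rewrite mulr_ge0 ?divr_ge0 ?addr_ge0 ?invr_ge0// ?ltW ?divr_gt0.
pose C := \sum_i (D i + Z i) + 1.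
have S0 : 0 <= \sum_i (D i + Z i) by apply: sumr_ge0 => i _; rewrite addr_ge0.
have C0 : 0 < C by rewrite ltr_wpDl.
have DZC i : D i <= C /\ Z i <= C.
  have : D i + Z i <= C.
    rewrite /C (bigD1 i)//= -addrA lerDl addr_ge0// sumr_ge0// => j _.
    by rewrite addr_ge0.
  by move: (D0 i) (Z0 i) => ? ? ?; split; lra.
exists C => // w w' wr w'r.
set t := w 0 _; set t' := w' 0 _; move=> tt tt'.
have t0 : 0 < t := lt_le_trans tau0 tt.
have t'0 : 0 < t' := lt_le_trans tau0 tt'.
set e := `|_ - cone_param c w'|.
have eE i : lam i * `|t *: c i (factor_part w i) - t' *: c i (factor_part w' i)| <= e.
  rewrite -(gtr0_norm (lam0 i)) -normrZ.
  have -> : lam i *: (t *: c i (factor_part w i) - t' *: c i (factor_part w' i)) =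
      submxrow (G w - G w') i.
    rewrite submxrowB !submxrowZ !submxrow_product_point scalerBr.
    by rewrite !scalerA ![lam i * _]mulrC.
  apply: norm_mx_le => [|a b]; first exact: normr_ge0.
  by rewrite mxE norm_coord.
have eE' i : `|t *: c i (factor_part w i) - t' *: c i (factor_part w' i)| <= e / lam i.
  by rewrite ler_pdivlMr// mulrC.
have tD i : `|t - t'| <= D i * e.
  rewrite (le_trans (dist_scale_unit (c1 _ _ (wr i)) (c1 _ _ (w'r i)) t0 t'0))//.
  by rewrite /D -mulrA ler_wpM2l// mulrC.
have zZ i : `|factor_part w i - factor_part w' i| <= Z i * e.
  rewrite (le_trans (cK _ _ _ (wr i) (w'r i)))// /Z -mulrA ler_pM2l//.
  rewrite mulrAC ler_pdivlMr// mulrC.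
  set u := c i _; set u' := c i _.
  apply: (@le_trans _ _ (`|t *: (u - u')|)).
    by rewrite normrZ (gtr0_norm t0) ler_wpM2r.
  have -> : t *: (u - u') = (t *: u - t' *: u') - (t - t') *: u'.
    by apply/rowP => b; rewrite !mxE; ring.
  rewrite (le_trans (ler_normB _ _))// mulrDl; apply: lerD.
    by rewrite mul1r mulrC eE'.
  rewrite normrZ (le_trans _ (tD i))// -[leRHS]mulr1 ler_wpM2l//.
  exact: position_norm_le1 (c1 _ _ (w'r i)).
have e0 : 0 <= e by exact: normr_ge0.
apply: norm_mx_le => [|a b]; first by rewrite mulr_ge0// ltW.
rewrite ord1; elim/cone_row_ind: b => [|i b].
  rewrite !mxE (le_trans (tD (Ordinal n0)))// ler_wpM2r//.
  exact: (DZC _).1.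
rewrite !mxE -!factor_partE.
have := norm_coord (factor_part w i - factor_part w' i) 0 b.
rewrite !mxE => /le_trans; apply; rewrite (le_trans (zZ i))// ler_wpM2r//.
exact: (DZC _).2.
Qed.
End ConeParam.

Lemma continuous_mx (R : realType) (T : topologicalType) (m d : nat) (x : T)
    (f : T -> 'M[R]_(m, d)) :
  (forall i j, {for x, continuous (fun y => f y i j)}) -> {for x, continuous f}.
Proof.
move=> cf A [P Pnbhs PA].
have : \forall y \near x, forall i j, P i j (f y i j).
  apply: filter_forall => i; apply: filter_forall => j.
  exact: cf (Pnbhs i j).
by apply: filterS => y Py; exact: PA.
Qed.

Lemma continuous_emb_entry (R : realType) (n : nat) (d : 'I_n -> nat)
    (T : topologicalType) (x : T) i (v : T -> 'rV[R]_(d i)) j :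
  (forall l, {for x, continuous (fun y => v y 0 l)}) ->
  {for x, continuous (fun y => emb (v y) 0 j)}.
Proof.
rewrite -(tagnat.sig2K j); set i' := tagnat.sig1 j; set b := tagnat.sig2 j.
rewrite -/i' in b *; move: i' b => i' b cv.
have [ii'|ii'] := eqVneq i i'; last first.
  have -> : (fun y => emb (v y) 0 (tagnat.Rank i' b)) = cst (0 : R).
    by apply/funext => y; rewrite emb_Rank submxrow_emb_neq// mxE.
  exact: cst_continuous.
case: i' / ii' in b *.
have -> : (fun y => emb (v y) 0 (tagnat.Rank i b)) = (fun y => v y 0 b).
  by apply/funext => y; rewrite emb_Rank submxrow_emb.
exact: cv.
Qed.

Lemma continuous_cone_frame (R : realType) (n : nat) (k d : 'I_n -> nat)
    (T : topologicalType) (t : T)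
    (x : forall i, T -> 'rV[R]_(d i)) (B : forall i, T -> 'M[R]_(k i, d i)) r j :
  (forall i, {for t, continuous (x i)}) -> (forall i, {for t, continuous (B i)}) ->
  {for t, continuous (fun s =>
     cone_frame (product_point k (fun i => x i s)) (fun i => B i s) r j)}.
Proof.
move=> cx cB.
have cxe i l : {for t, continuous (fun s => x i s 0 l)}.
  apply: (@continuous_comp _ _ _ (x i) (fun m : 'rV[R]_(d i) => m 0 l)).
    exact: cx.
  exact: coord_continuous.
have cBe i a l : {for t, continuous (fun s => B i s a l)}.
  apply: (@continuous_comp _ _ _ (B i) (fun m : 'M[R]_(k i, d i) => m a l)).
    exact: cB.
  exact: coord_continuous.
have rowE (A : 'M[R]_(1 + \sum_i k i, \sum_i d i)) q : A q j = row q A 0 j.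
  by rewrite mxE.
elim/cone_row_ind: r => [|i a].
  have -> : (fun s => cone_frame (product_point k (fun i => x i s))
      (fun i => B i s) (radial_row k) j) =
      (fun s => \sum_i minimal_weight R k i * emb (x i s) 0 j).
    apply/funext => s; rewrite rowE row_cone_frame0 product_point_sum summxE.
    by apply: eq_bigr => i _; rewrite mxE.
  apply: cvg_big => [|i _]; first exact: add_continuous.
  by apply: cvgMr; exact: continuous_emb_entry.
have -> : (fun s => cone_frame (product_point k (fun i => x i s))
    (fun i => B i s) (factor_row a) j) = (fun s => emb (row a (B i s)) 0 j).
  by apply/funext => s; rewrite rowE row_cone_frame.
apply: continuous_emb_entry => l.
have -> : (fun s => row a (B i s) 0 l) = (fun s => B i s a l).
  by apply/funext => s; rewrite mxE.
exact: cBe.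
Qed.

Lemma continuous_gram (R : realType) (T : topologicalType) (t : T) (m d : nat)
    (E : T -> 'M[R]_(m, d)) :
  (forall i j, {for t, continuous (fun s => E s i j)}) ->
  {for t, continuous (fun s => \det (E s *m (E s)^T))}.
Proof.
move=> cE; apply: (@continuous_form R _ _ _ (fun=> fun A : 'M[R]_m => \det A)).
- by move=> _; exact: det_multilinear_alternating.
- by move=> C; exact: cvg_cst.
- move=> i j.
  have gramE s : (E s *m (E s)^T) i j = \sum_l E s i l * E s j l.
    by rewrite mxE; apply: eq_bigr => l _; rewrite mxE.
  under eq_fun do rewrite gramE.
  rewrite gramE; apply: cvg_big => [|l _]; first exact: add_continuous.
  by apply: cvgM; exact: cE.
Qed.

Section CalibratedFrame.
Variables (R : realType) (n : nat) (k d : 'I_n -> nat).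
Variable L : forall i, oriented_set R (d i) (k i).
Hypothesis n_gt0 : (0 < n)%N.
Hypothesis k_gt0 : forall i, (0 < k i)%N.
Hypothesis L_emb : forall i, embedded_submanifold (k i) (carrier (L i)).
Hypothesis L_ori : forall i, is_orientation (L i).
Hypothesis L_sph : forall i, carrier (L i) `<=` @unit_sphere R (d i).
Variable phi : dform R (\sum_i d i) (1 + \sum_i k i).

(** Otherwise, by continuity, the form differs from the volume on the frames at
    all points [t x] of the cone with [t > 0] small and [x] close to the given
    point of the link; these bad points contain the expanding image of a cube
    and cannot form a null set. *)
Lemma calibrated_frame x B :
  smooth_form phi -> calibrates phi (cone (minimal_product L)) ->
  (forall i, carrier (L i) (x i)) -> (forall i, pos_frame (L i) (x i) (B i)) ->
  let E := cone_frame (product_point k x) B in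
  phi 0 E ^+ 2 = \det (E *m E^T).
Proof.
move=> [hphi sphi] cal Lx Bpos E.
apply/eqP/negP => /negP ne.
have H i := local_param (L_emb i) (L_ori i) (Lx i) (Bpos i).
have /fin_all_exists[c H1] := H.
have /fin_all_exists[F H2] := H1.
have /fin_all_exists[r H3] := H2.
have /fin_all_exists[K H4] := H3.
pose X := link_param c; pose G := cone_param c.
pose Fr w := cone_frame (X w) (fun i => F i (factor_part w i)).
pose Q w := phi (G w) (Fr w) * phi (G w) (Fr w) - \det (Fr w *m (Fr w)^T).
pose m := (1 + \sum_i k i)%N.
have cxX i : {for (0 : 'rV[R]_m), continuous (fun w => c i (factor_part w i))}.
  by apply: continuous_factor_part; have [_ _ _ _ []] := H4 i.
have cFX i : {for (0 : 'rV[R]_m), continuous (fun w => F i (factor_part w i))}.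
  by apply: continuous_factor_part; have [_ _ _ _ []] := H4 i.
have cFr a b : {for (0 : 'rV[R]_m), continuous (fun w => Fr w a b)}.
  exact: continuous_cone_frame.
have cG : {for (0 : 'rV[R]_m), continuous G}.
  apply: continuous_mx => a b; rewrite ord1.
  have -> : (fun w => G w 0 b) =
      (fun w : 'rV[R]_m => w 0 (radial_row k) * Fr w (radial_row k) b).
    apply/funext => w; rewrite mxE; congr (_ * _).
    have := row_cone_frame0 (X w) (fun i => F i (factor_part w i)).
    by move/rowP/(_ b) => <-; rewrite mxE.
  have ct : {for (0 : 'rV[R]_m), continuous (fun w : 'rV[R]_m => w 0 (radial_row k))}.
    exact: coord_continuous.
  exact: (continuousM ct (cFr _ _)).
have X0 : X 0 = product_point k x.
  apply: eq_mxrow => i; rewrite factor_part0.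
  by have [_ [-> _] _ _ _] := H4 i.
have G0 : G 0 = 0 by rewrite /G /cone_param mxE scale0r.
have Fr0 : Fr 0 = E.
  rewrite /Fr X0; congr col_mx; apply/matrixP => a b; rewrite !mxE.
  rewrite factor_part0.
  by have [_ [_ ->] _ _ _] := H4 (tagnat.sig1 a).
have cQ : {for (0 : 'rV[R]_m), continuous Q}.
  have cphi : {for (0 : 'rV[R]_m), continuous (fun w => phi (G w) (Fr w))}.
    apply: (@continuous_form R _ _ _ (fun w => phi (G w))).
    - by move=> w; exact: hphi.
    - move=> C; apply: (@continuous_comp _ _ _ G (phi ^~ C)) => //.
      exact: (sphi C 0%N).
    - exact: cFr.
  exact: (continuousB (continuousM cphi cphi) (continuous_gram cFr)).
have Q0 : Q 0 != 0 by rewrite /Q G0 Fr0 subr_eq0 -expr2.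
have nQ : nbhs (0 : 'rV[R]_m) [set w | Q w != 0].
  apply: (cQ [set y | y != 0]); apply/nbhs_ballP; exists `|Q 0|.
    by rewrite /= normr_gt0.
  by move=> y; rewrite -ball_normE/=; apply: contraTneq => ->; rewrite subr0 ltxx.
have : \forall w \near (0 : 'rV[R]_m), Q w != 0 /\ forall i, `|factor_part w i| < r i.
  near=> w; split; near: w; first exact: nQ.
  apply: filter_forall => i; have [[r0 _] _ _ _ _] := H4 i.
  have := nbhsx_ballx (0 : 'rV[R]_m) (r i) r0; apply: filterS => w.
  rewrite -ball_normE/= sub0r normrN; apply: le_lt_trans.
  exact: factor_part_le.
move=> /nbhs_ballP[e /= e0 He].
have {}He w : `|w| < e -> Q w != 0 /\ forall i, `|factor_part w i| < r i.
  by move=> we; apply: He; rewrite -ball_normE/= sub0r normrN.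
pose rho := e / 4.
have rho0 : 0 < rho by rewrite divr_gt0.
have [|||C C0 GC] := @cone_param_expanding R n k d k_gt0 c r K rho n_gt0 rho0.
- by move=> i; have [[_]] := H4 i.
- move=> i z zr; apply: (@L_sph i).
  by have [_ _ h _ _] := H4 i; have [] := h z zr.
- by move=> i; have [_ _ _ h _] := H4 i.
(* The coordinates of [W z] lie in [[rho, 2 rho]]: this keeps the parameter
   within [e] of the apex, and the radial coordinate away from 0. *)
pose W (z : 'rV[R]_m) := rho *: (z + const_mx 1).
have We z : unit_cube z -> `|W z| < e.
  move=> z01; rewrite normrZ (gtr0_norm rho0) (le_lt_trans (_ : _ <= rho * 2))//.
    rewrite ler_pM2l//; apply: norm_mx_le => // a b; rewrite !mxE ord1.
    have /andP[z0 z1] := z01 b; rewrite ger0_norm; last by rewrite addr_ge0.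
    by lra.
  by rewrite /rho; lra.
have Wt z : unit_cube z -> rho <= W z 0 (radial_row k).
  move=> z01; rewrite !mxE -[leLHS]mulr1 ler_pM2l// lerDr.
  by have /andP[] := z01 (radial_row k).
apply: (@hausdorff_expanding R m _ _ (G \o W) (C / rho) _ _ _ _ cal) => //.
- by rewrite divr_gt0.
- move=> z z01; have [Qz zr] := He _ (We _ z01).
  apply: (@cone_bad_point R n k d L k_gt0 L_ori L_sph phi
    (fun i => c i (factor_part (W z) i)) (fun i => F i (factor_part (W z) i))) => //.
  + by move=> i; have [_ _ h _ _] := H4 i; have [] := h _ (zr i).
  + by move=> i; have [_ _ h _ _] := H4 i; have [] := h _ (zr i).
  + exact: (lt_le_trans rho0 (Wt _ z01)).
  + by rewrite -subr_eq0 expr2; exact: Qz.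
- move=> z z' z01 z'01.
  have := GC _ _ (He _ (We _ z01)).2 (He _ (We _ z'01)).2 (Wt _ z01) (Wt _ z'01).
  rewrite -/(G _) -/(G _) /= => h.
  rewrite mulrAC ler_pdivlMr// mulrC (le_trans _ h)//.
  rewrite -{1}(gtr0_norm rho0) -normrZ.
  by rewrite /W -scalerBr opprD addrACA subrr addr0.
Unshelve. all: by end_near. Qed.
End CalibratedFrame.

(** * Constant forms *)

(** Scaling one vector of the frame [F] reduces to unit volume, where the comass
    bounds the form; both signs of the scaling factor are needed. *)
Lemma calibration_le_volume (R : realType) (d m : nat) (phi : dform R d m)
    (i : 'I_m) x F :
  calibration phi -> 0 < \det (F *m F^T) -> phi x F ^+ 2 <= \det (F *m F^T).
Proof.
move=> [[hphi _] _ sup1] g0; set g := \det _ in g0 *.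
have s0 : 0 < Num.sqrt g by rewrite sqrtr_gt0.
have le1 E : unit_simple E -> phi x E <= 1.
  move=> E1; rewrite -lee_fin -sup1.
  apply: (@le_trans _ _ (comass (phi x))).
    by apply: ereal_sup_ubound; exists E.
  by apply: ereal_sup_ubound; exists x.
have le_s u : u ^+ 2 = 1 -> u * phi x F <= Num.sqrt g.
  move=> u1; have : unit_simple (set_row i ((u / Num.sqrt g) *: row i F) F).
    rewrite /unit_simple gram_scale_row -/g exprMn u1 mul1r exprVn sqr_sqrtr ?ltW//.
    by rewrite mulVf// gt_eqF.
  move=> /le1; rewrite (form_set_rowZ (hphi x)) set_row_id mulrAC.
  by rewrite ler_pdivrMr// mul1r.
have h1 := le_s 1 (expr1n _ _); have h2 := le_s (-1) (etrans (sqrrN 1) (expr1n _ _)).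
have gE : g = Num.sqrt g ^+ 2 by rewrite sqr_sqrtr// ltW.
by rewrite [leRHS]gE; move: h1 h2 s0; nra.
Qed.

(** With the notation of the introduction, [homa] and the last part of the proof
    show that the contraction of [om] with the position vector vanishes along
    the factor [i0], and [no_radially_null_form] applies to [om]. *)
Lemma no_constant_calibration (R : realType) (n : nat) (k d : 'I_n -> nat)
    (L : forall i, oriented_set R (d i) (k i))
    (w : 'M[R]_(1 + \sum_i k i, \sum_i d i) -> R) (i0 i1 : 'I_n) :
  i0 != i1 ->
  (forall i, (0 < k i)%N) ->
  (forall i, carrier (L i) !=set0) ->
  (forall i, embedded_submanifold (k i) (carrier (L i))) ->
  (forall i, is_orientation (L i)) ->
  (forall i, carrier (L i) `<=` @unit_sphere R (d i)) ->
  multilinear_alternating w ->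
  (forall F, 0 < \det (F *m F^T) -> w F ^+ 2 <= \det (F *m F^T)) ->
  (forall x B, (forall i, carrier (L i) (x i)) ->
     (forall i, pos_frame (L i) (x i) (B i)) ->
     let E := cone_frame (product_point k x) B in
     w E ^+ 2 = \det (E *m E^T)) ->
  False.
Proof.
move=> i01 k0 L_ne L_emb L_ori L_sph hw wle wE.
have /fin_all_exists[p Lp] : forall i, exists q, carrier (L i) q.
  by move=> i; have [q Lq] := L_ne i; exists q.
have /fin_all_exists[B Bpos] : forall i, exists V, pos_frame (L i) (p i) V.
  move=> i; have [_ _ /(_ _ (Lp i))[U [F [_ Up _ Fpos]]]] := L_ori i.
  by exists (F (p i)); exact: Fpos.
pose lam i := minimal_weight R k i.
have lam_gt0 i : 0 < lam i := minimal_weight_gt0 R k0 i.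
pose x' := \sum_(i | i != i0) lam i *: emb (p i).
pose l := lam i0; pose mu := 1 - l ^+ 2.
have sum_sqr : l ^+ 2 + \sum_(i | i != i0) lam i ^+ 2 = 1.
  by rewrite -(sum_minimal_weight_sqr R k0 i0) [RHS](bigD1 i0).
have muE : mu = \sum_(i | i != i0) lam i ^+ 2.
  by rewrite /mu -sum_sqr addrAC subrr add0r.
have mu0 : 0 < mu.
  rewrite muE (bigD1 i1) 1?eq_sym//= ltr_pwDl ?exprn_gt0//.
  by apply: sumr_ge0 => i _; rewrite sqr_ge0.
have x'i0 : submxrow x' i0 = 0.
  rewrite submxrow_sum big1// => i ii0.
  by rewrite submxrowZ submxrow_emb_neq// scaler0.
have x'i i : i != i0 -> submxrow x' i = lam i *: p i.
  move=> ii0; rewrite submxrow_sum (bigD1 i)//= submxrowZ submxrow_emb.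
  rewrite big1 => [|j /andP[_ ji]]; first by rewrite [LHS]addr0.
  by rewrite submxrowZ submxrow_emb_neq// scaler0.
pose X (q : 'rV[R]_(d i0)) := product_point k (dfwith p q).
have XE q : X q = l *: emb q + x'.
  rewrite /X product_point_sum [LHS](bigD1 i0)//= dfwith_in; congr (_ + _).
  by apply: eq_bigr => i ii0; rewrite dfwith_out// eq_sym.
pose y (q : 'rV[R]_(d i0)) := mu *: emb q - l *: x'.
have xL q : carrier (L i0) q -> forall i, carrier (L i) (dfwith p q i).
  move=> Lq i; have [<-|i0i] := eqVneq i0 i; first by rewrite dfwith_in.
  by rewrite dfwith_out.
pose E q (V : 'M[R]_(k i0, d i0)) := cone_frame (X q) (dfwith B V).
have posE q V : carrier (L i0) q -> pos_frame (L i0) q V ->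
    forall i, pos_frame (L i) (dfwith p q i) (dfwith B V i).
  move=> Lq Vpos i; have [<-|i0i] := eqVneq i0 i; first by rewrite !dfwith_in.
  by rewrite !dfwith_out.
have yE q V : carrier (L i0) q -> pos_frame (L i0) q V ->
    forall r, dot (y q) (row r (E q V)) = 0.
  move=> Lq Vpos r; have q1 := L_sph _ _ Lq.
  elim/cone_row_ind: r => [|i a].
    rewrite row_cone_frame0 XE dotDr dotZr (dotC _ (emb q)) dot_emb.
    rewrite submxrowB !submxrowZ submxrow_emb x'i0 scaler0 subr0 dotZr q1 mulr1.
    rewrite dot_submxrow (bigD1 i0)//= x'i0 [dot _ 0]dotC {1}/dot mul0mx mxE add0r.
    rewrite (eq_bigr (fun i => - l * lam i ^+ 2)) => [|i ii0].
      by rewrite -mulr_sumr -muE; ring.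
    rewrite submxrowB !submxrowZ submxrow_emb_neq 1?eq_sym// scaler0 sub0r.
    rewrite -scaleNr x'i// !(dotZl, dotZr) (L_sph _ _ (Lp i)); ring.
  rewrite row_cone_frame dotC dot_emb submxrowB !submxrowZ.
  have [i0i|i0i] := eqVneq i0 i.
    case: i / i0i in a *.
    rewrite submxrow_emb x'i0 scaler0 subr0 dfwith_in dotZr dotC.
    by rewrite (pos_frame_orth L_ori L_sph Lq Vpos) mulr0.
  rewrite submxrow_emb_neq// scaler0 sub0r x'i 1?eq_sym// dfwith_out//.
  rewrite -scaleNr !dotZr dotC.
  by rewrite (pos_frame_orth L_ori L_sph (Lp i) (Bpos i)) !mulr0.
have E_gt0 q V : carrier (L i0) q -> pos_frame (L i0) q V ->
    0 < \det (E q V *m (E q V)^T).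
  move=> Lq Vpos; apply: gram_gt0; apply: (row_free_cone_frame k0) => //.
  - by move=> i; exact: L_sph (xL q Lq i).
  - by move=> i a; exact: pos_frame_orth (xL q Lq i) (posE q V Lq Vpos i) a.
  - move=> i; have [ori1 _ _] := L_ori i.
    exact: (ori1 _ _ (xL q Lq i) (posE q V Lq Vpos i)).1.
have cousin q V r : carrier (L i0) q -> pos_frame (L i0) q V ->
    w (set_row r (y q) (E q V)) = 0.
  move=> Lq Vpos; apply: first_cousin => //.
  - exact: E_gt0.
  - exact: wE (xL q Lq) (posE q V Lq Vpos).
  - exact: yE.
pose om (V : 'M[R]_(k i0, d i0)) := w (cone_frame x' (dfwith B V)).
have homa a v V : om (set_row a v V) =
    w (set_row (factor_row a) (emb v) (cone_frame x' (dfwith B V))).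
  by rewrite set_row_cone_frame.
have hom : multilinear_alternating om.
  apply: multilinear_alternatingI => [i b c u v A|i j u A ij].
    by rewrite !homa embP (form_set_rowP hw).
  rewrite homa -set_row_cone_frame (form_dup hw)//.
  by rewrite factor_row_inj.
apply: (no_radially_null_form (k0 i0) (L_emb i0) (L_ori i0) (Lp i0) hom).
move=> q V Lq Vpos; pose rho := radial_row k.
have setE u : set_row rho u (E q V) = cone_frame u (dfwith B V).
  by rewrite set_row_cone_frame0.
split=> [|a].
  have x'E : x' = mu *: X q + (- l) *: y q.
    by rewrite XE /y /mu; apply/rowP => j; rewrite !mxE; ring.
  rewrite /om -setE [X in set_row _ X]x'E (form_set_rowP hw) cousin// mulr0 addr0.
  rewrite setE -/(E q V) => /eqP; rewrite mulf_eq0 (gt_eqF mu0)/= => /eqP wE0.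
  have := E_gt0 q V Lq Vpos.
  rewrite -(wE _ _ (xL q Lq) (posE q V Lq Vpos)) -/(X q) -/(E q V) wE0.
  by rewrite expr0n ltxx.
pose r := factor_row a.
have rrho : r != rho by rewrite /r /rho eq_sym eq_lrshift.
(* [S] is bilinear and alternating, and [S (X q) (y q) = S x' (emb q)] because
   the change of basis from [(x', emb q)] to [(X q, y q)] has determinant
   [l ^+ 2 + mu = 1]. *)
pose S u v := w (set_row r v (set_row rho u (E q V))).
have SDl b c u u1 v : S (b *: u + c *: u1) v = b * S u v + c * S u1 v.
  by rewrite /S !(set_rowC _ _ _ rrho) (form_set_rowP hw).
have SDr b c u v v1 : S u (b *: v + c *: v1) = b * S u v + c * S u v1.
  by rewrite /S (form_set_rowP hw).
have Suu u : S u u = 0 by rewrite /S (form_dup hw).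
have Santi u v : S u v = - S v u by rewrite /S (form_swap hw).
have := cousin q V r Lq Vpos.
have <- : S (X q) (y q) = w (set_row r (y q) (E q V)).
  by rewrite /S setE.
rewrite homa -setE -/(S x' (emb q)).
rewrite XE -[X in S (_ + X)]scale1r SDl /y -scaleNr !SDr !Suu (Santi (emb q)).
by move=> h; rewrite -[RHS]h /mu; ring.
Qed.

Theorem theorem1p3 (R : realType) (n : nat) (N k : 'I_n -> nat)
    (L : forall i : 'I_n, oriented_set R (N i).+1 (k i))
    (n_ge2 : (2 <= n)%N)
    (k_gt0 : forall i, (0 < k i)%N)
    (L_closed : forall i, closed_oriented_submanifold (L i))
    (L_minimal : forall i, minimal_in_sphere (k i) (carrier (L i))) :
  ~ exists phi : dform R (\sum_(i < n) (N i).+1)%N (1 + \sum_(i < n) k i)%N,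
      calibration phi /\ calibrates phi (cone (minimal_product L)).
Proof.
move=> [phi [phi_cal phi_C]]; have [phi_smooth _ _] := phi_cal.
have L_ne i : carrier (L i) !=set0 by have [] := L_closed i.
have L_emb i : embedded_submanifold (k i) (carrier (L i)).
  by have [] := L_closed i.
have L_ori i : is_orientation (L i) by have [] := L_closed i.
have L_sph i : carrier (L i) `<=` @unit_sphere R (N i).+1.
  by have [] := L_minimal i.
have n_gt0 : (0 < n)%N by exact: leq_trans n_ge2.
apply: (@no_constant_calibration R n k (fun i => (N i).+1) L (phi 0)
  (Ordinal n_gt0) (Ordinal n_ge2)) => //.
- exact: phi_smooth.1.
- by move=> F; exact: (calibration_le_volume (radial_row k)).
- by move=> x B Lx Bpos; exact: (calibrated_frame n_gt0 k_gt0 L_emb L_ori L_sph).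
Qed.
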